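(* Let $n\ge 2$ and $\alpha\in(0,1)$. There is a constant $\delta_0>0$ depending only on $n$ and $\alpha$ such that the following holds. Let $0<\lambda\le\Lambda$, let $\Omega\subset\mathbb{R}^n_+=\{x_n>0\}$ be a bounded convex domain with $0\in\partial\Omega$, and let $u:\overline{\Omega}\to\mathbb{R}$ be a convex, continuous solution to $$\det D^2u=f\ \text{ in }\Omega,\qquad u=\varphi\ \text{ on }\partial\Omega,$$ where $\lambda\le f\le\Lambda$ in $\Omega$. Assume that $\Omega$ is uniformly convex at $0$, and that $\partial\Omega$ and $\varphi$ are pointwise $C^{2,\alpha}$ at $0$, i.e. there are quadratic polynomials $p(x'),q(x')$ such that, for $x=(x',x_n)\in\partial\Omega$ near $0$, $$x_n=q(x')+O(|x'|^{2+\alpha}),\qquad \varphi(x)=p(x')+O(|x'|^{2+\alpha}).$$ Then $u\in C^{1,\delta_0}(0)$.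
   Context: Points of $\mathbb{R}^n$ are written $x=(x',x_n)$ with $x'\in\mathbb{R}^{n-1}$. Solutions of $\det D^2u=f$ are understood in the Alexandrov sense. A quadratic polynomial is a polynomial of degree at most $2$ (linear and constant terms allowed). Uniform convexity at $0$ (for $\Omega\subset\mathbb{R}^n_+$ bounded convex, $0\in\partial\Omega$): there is $\kappa>0$ such that $x_n\ge\kappa|x|^2$ for all $x\in\partial\Omega$ (for bounded convex $\Omega$ this is equivalent, up to changing $\kappa$, to requiring it for $x\in\partial\Omega$ near $0$). Pointwise regularity: for an integer $k\ge0$ and $0<\gamma\le1$, $u\in C^{k,\gamma}(x_0)$ means that there is a polynomial $P_{x_0}$ of degree $k$ such that $u(x)=P_{x_0}(x)+O(|x-x_0|^{k+\gamma})$ (for $x$ in the domain of definition of $u$; here $x\in\overline{\Omega}$). *)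

(* Defs.v *)
From HB Require Import structures.
From mathcomp Require Import all_boot all_order all_algebra.
(* The notations of mpoly clash with those of analysis. *)
From mathcomp Require Import -(notations) mpoly.
From mathcomp Require Import all_classical all_reals all_analysis.
Set Implicit Arguments.
Unset Strict Implicit.
Unset Printing Implicit Defensive.
Import Order.TTheory GRing.Theory Num.Theory numFieldNormedType.Exports.
Local Open Scope classical_set_scope.
Local Open Scope ring_scope.

Section Euclidean.
Context {R : realType}.

Definition dotv n (x y : 'rV[R]_n) : R := \sum_i x 0 i * y 0 i.

(* The norm `|x| that the library puts on 'rV[R]_n is the sup norm; it is used
   here only through the topology and the bounded sets that it defines. *)
Definition enorm n (x : 'rV[R]_n) : R := Num.sqrt (dotv x x).

Definition xlast n (x : 'rV[R]_n.+1) : R := x 0 ord_max.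

Definition xinit n (x : 'rV[R]_n.+1) : 'rV[R]_n :=
  \row_(i < n) x 0 (widen_ord (leqnSn n) i).

Definition half_space n : set 'rV[R]_n.+1 := [set x | 0 < xlast x].

Definition bdry n (A : set 'rV[R]_n) : set 'rV[R]_n := closure A `\` interior A.

End Euclidean.

Section LebesgueMeasure.
Context {R : realType} {n : nat}.
Local Notation V := 'rV[R]_n.+1.

(* The half-open box of corners ab.1 and ab.2; it is empty, of volume 0,
   unless ab.1 < ab.2 in every coordinate. *)
Definition box (ab : V * V) : set V :=
  [set x | forall i, ab.1 0 i < x 0 i <= ab.2 0 i].

Definition box_volume (ab : V * V) : R :=
  \prod_i Num.max (ab.2 0 i - ab.1 0 i) 0.

Definition box_cover (A : set V) : set (nat -> V * V) :=
  [set B | A `<=` \bigcup_k box (B k)].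

Definition lebesgue_outer (A : set V) : \bar R :=
  ereal_inf [set (\sum_(k <oo) (box_volume (B k))%:E)%E | B in box_cover A].

Lemma box_volume_ge0 ab : 0 <= box_volume ab.
Proof. by apply: prodr_ge0 => i _; rewrite le_max lexx orbT. Qed.

Local Open Scope ereal_scope.

Let box_volume_ge0E ab : 0 <= (box_volume ab)%:E.
Proof. by rewrite lee_fin box_volume_ge0. Qed.

Lemma lebesgue_outer_ge0 A : 0 <= lebesgue_outer A.
Proof.
by apply: le_ereal_inf_tmp => _ [B _ <-]; apply: nneseries_ge0 => k _ _.
Qed.

Lemma lebesgue_outer0 : lebesgue_outer set0 = 0.
Proof.
apply/eqP; rewrite eq_le lebesgue_outer_ge0 andbT.
apply: ereal_inf_lbound; exists (fun=> (0%R, 0%R)); first exact: sub0set.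
apply: eseries0 => k _ _; congr EFin.
by rewrite /box_volume big_ord_recl /= subrr maxxx mul0r.
Qed.

Lemma le_lebesgue_outer : {homo lebesgue_outer : A B / A `<=` B >-> A <= B}.
Proof.
move=> A B AB; apply/ereal_inf_le_tmp => _ [F BF <-].
by exists F => //; apply: subset_trans BF.
Qed.

Lemma lebesgue_outer_sigma_subadditive : sigma_subadditive lebesgue_outer.
Proof.
move=> A; have [[i ioo]|] := pselect (exists i, lebesgue_outer (A i) = +oo).
  rewrite (eseries_pinfty _ _ ioo) ?leey// => k _.
  by rewrite -ltNye (lt_le_trans _ (lebesgue_outer_ge0 _)).
rewrite -forallNE => Aoo.
apply/lee_addgt0Pr => e e0.
rewrite (le_trans _ (epsilon_trick _ _ (ltW e0)))//; last first.
  by move=> k; exact: lebesgue_outer_ge0.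
pose P k (B : nat -> V * V) := box_cover (A k) B /\
  \sum_(j <oo) (box_volume (B j))%:E <=
  lebesgue_outer (A k) + (e / (2 ^ k.+1)%:R)%:E.
have [G PG] : {G : nat -> nat -> V * V & forall k, P k (G k)}.
  apply: (@choice _ _ P) => k.
  have fA : lebesgue_outer (A k) \is a fin_num.
    rewrite ge0_fin_numE ?lebesgue_outer_ge0// ltey.
    by apply/eqP; exact: Aoo.
  have ek : (0 < e / (2 ^ k.+1)%:R)%R by rewrite divr_gt0// ltr0n expn_gt0.
  have [_ [B AB <-] xS] := lb_ereal_inf_adherent ek fA.
  by exists B; split => //; exact/ltW.
pose w (ij : nat * nat) := (box_volume (G ij.1 ij.2))%:E.
have w0 ij : 0 <= w ij by exact: box_volume_ge0E.
apply: (@le_trans _ _ (\esum_(ij in setT) w ij)).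
  have /card_esym/ppcard_eqP[g] := card_nat2.
  apply: ereal_inf_lbound => /=.
  exists (fun k => G (g k).1 (g k).2).
    move=> t [i _ /(PG i).1 [j _ tij]].
    by exists (g^-1%FUN (i, j)) => //=; rewrite invK ?inE.
  rewrite -[RHS](_ : \esum_(ij in g @` setT) w ij = _); last first.
    by rewrite image_eq.
  by rewrite -(esum_pred_image w _ xpredT) ?[fun=> _]set_true// => *.
rewrite (_ : esum _ _ = \sum_(i <oo) \sum_(j <oo) w (i, j)); last first.
  pose J : nat -> set (nat * nat) := fun i => [set (i, j) | j in setT].
  rewrite (_ : setT = \bigcup_k J k); last first.
    by rewrite predeqE => -[a b]; split => // _; exists a => //; exists b.
  rewrite esum_bigcupT //=; last first.
    apply/trivIsetP => i j _ _ ij.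
    rewrite predeqE => -[k l] /=; split => //= -[] [_] _ [<-{k} _].
    by move=> [l' _] [] /esym/eqP; rewrite (negbTE ij).
  rewrite -(image_id [set: nat]) -fun_true esum_pred_image//; last first.
    by move=> k _; exact: esum_ge0.
  apply: eq_eseriesr => /= j _.
  rewrite -(esum_pred_image w (pair j) predT)//=; last first.
    by move=> ? ? _ _; exact: (@can_inj _ _ _ snd).
  by congr esum; rewrite predeqE => -[a b]; split; move=> [i _ <-]; exists i.
apply: lee_nneseries => [k _ _|k _]; last exact: (PG k).2.
exact: nneseries_ge0.
Qed.

HB.instance Definition _ := isOuterMeasure.Build R V lebesgue_outer
  lebesgue_outer0 lebesgue_outer_ge0 le_lebesgue_outer
  lebesgue_outer_sigma_subadditive.

(* R^(n+1) with the sigma-algebra of Lebesgue measurable sets. *)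
Definition lebesgue_space := caratheodory_type lebesgue_outer.

HB.instance Definition _ := Measurable.copy lebesgue_space
  (caratheodory_type (lebesgue_outer : {outer_measure set V -> \bar R})).

Definition lebesgueRn : set lebesgue_space -> \bar R := lebesgue_outer.

HB.instance Definition _ := isMeasure.Build _ lebesgue_space R lebesgueRn
  (@caratheodory_measure0 _ V lebesgue_outer)
  (@caratheodory_measure_ge0 _ V lebesgue_outer)
  (@caratheodory_measure_sigma_additive _ V lebesgue_outer).

End LebesgueMeasure.
Arguments lebesgue_space : clear implicits.

Section MongeAmpere.
Context {R : realType} {n : nat}.
Implicit Types (Omega E : set 'rV[R]_n.+1) (u f : 'rV[R]_n.+1 -> R).

Definition subdifferential Omega u (x : 'rV[R]_n.+1) : set 'rV[R]_n.+1 :=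
  [set p | forall y, Omega y -> u x + dotv p (y - x) <= u y].

Definition normal_image Omega u E : set 'rV[R]_n.+1 :=
  \bigcup_(x in E) subdifferential Omega u x.

Definition monge_ampere_measure Omega u E : \bar R :=
  lebesgueRn (normal_image Omega u E).

(* det D^2 u = f in Omega in the sense of Alexandrov; <<s open >> is the Borel
   sigma-algebra. *)
Definition alexandrov_solution Omega f u : Prop :=
  measurable_fun (Omega : set (lebesgue_space R n)) f /\
  forall E, <<s open >> E -> E `<=` Omega ->
    monge_ampere_measure Omega u E = (\int[lebesgueRn]_(x in E) (f x)%:E)%E.

End MongeAmpere.

Section PointwiseRegularity.
Context {R : realType}.

Definition polynomial_fun n (k : nat) (P : 'rV[R]_n -> R) : Prop :=
  exists p : mpoly.mpoly n R, (mpoly.msize p <= k.+1)%N /\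
    forall x, P x = mpoly.meval (fun i => x 0 i) p.

Definition pointwiseC n (k : nat) (gamma : R) (D : set 'rV[R]_n)
    (u : 'rV[R]_n -> R) (x0 : 'rV[R]_n) : Prop :=
  exists2 P : 'rV[R]_n -> R, polynomial_fun k P &
    (fun x => u x - P x : R^o) =O_ (within D (nbhs x0))
    (fun x => enorm (x - x0) `^ (k%:R + gamma) : R^o).

(* g, a function on the boundary of Omega, agrees at 0 with a quadratic
   polynomial in x' up to O(|x'|^(2 + alpha)). *)
Definition bdry_pointwiseC2 n (alpha : R) (Omega : set 'rV[R]_n.+1)
    (g : 'rV[R]_n.+1 -> R) : Prop :=
  exists2 q : 'rV[R]_n -> R, polynomial_fun 2 q &
    (fun x => g x - q (xinit x) : R^o) =O_ (within (bdry Omega) (nbhs (0 : 'rV[R]_n.+1)))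
    (fun x => enorm (xinit x) `^ (2 + alpha) : R^o).

Definition uniformly_convex_at0 n (Omega : set 'rV[R]_n.+1) : Prop :=
  exists2 kappa : R, 0 < kappa &
    forall x, bdry Omega x -> kappa * enorm x ^+ 2 <= xlast x.

End PointwiseRegularity.

(* Main.v *)
(** The proof uses only the upper bound on [f], through one comparison
    principle with quadratic polynomials. Subtracting the affine part of [phi]
    and the largest multiple [a x_n] that stays below leaves a convex
    [w >= 0] with [w(0) = 0], [w <= K x_n] and [inf w / x_n = 0]; on the
    boundary, [w] is a quadratic form [P(x') >= 0] up to
    [O(|x'|^(2 + alpha))]. By convexity along horizontal slices, of radius
    comparable to [sqrt x_n], it is enough to bound [w] on the [x_n]-axis.
    - If [P] vanishes in some direction [e], the boundary points [(+-s e, t)],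
      with [s] of order [sqrt t], give [w(0, t) = O(t^(1 + alpha / 2))].
    - If [P] is positive definite, [w >= c x_n] on the boundary. A quadratic
      barrier shows that for each small [eps] some point at height [t] at least
      [tau eps^(n+1)] has [w <= eps x_n] (the dimension being [n + 1]).
      Shrinking it towards [0] down to the height [s = eps^2 (tau eps^(n+1))]
      and joining it horizontally to the axis yields [w(0, s) <= A eps s],
      that is [O(s^(1 + 1 / (n + 3)))]. *)
Require Import Defs.
From mathcomp Require Import all_boot all_order all_algebra.
From mathcomp Require Import -(notations) mpoly.
From mathcomp Require Import all_classical all_reals all_analysis.
From mathcomp Require Import measurable_realfun ring lra.
Set Implicit Arguments.
Unset Strict Implicit.
Unset Printing Implicit Defensive.
Import Order.TTheory GRing.Theory Num.Theory numFieldNormedType.Exports.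
Local Open Scope classical_set_scope.
Local Open Scope ring_scope.

(** * Weighted covers of the unit cube by boxes *)

Section BoxCovers.
Context {R : realType}.

Local Notation ind a b t := ((a < t <= b)%R : bool)%:R.

Lemma integral_unit_itv_le (a b : R) :
  (\int[lebesgue_measure]_(t in `]0%R, 1%R]) ((ind a b t : R)%:E) <=
   (Num.max (b - a) 0)%:E)%E.
Proof.
have -> : (fun t : R => (ind a b t : R)%:E) =
          (fun t => (\1_(`]a, b]%classic : set R) t)%:E).
  apply/funext => t; rewrite indicE; congr (_%:R%:E).
  by rewrite mem_setE in_itv.
rewrite integral_indic//.
apply: (@le_trans _ _ (lebesgue_measure (`]a, b]%classic : set R))).
  by apply: le_measure; rewrite ?inE//=; exact: measurableI.
rewrite lebesgue_measure_itv/= lte_fin; case: ifPn => ab.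
  by rewrite EFinN -EFinD lee_fin le_max lexx.
by rewrite lee_fin le_max lexx orbT.
Qed.

(* The weights make the induction on the dimension go through: integrating the
   covering inequality in one coordinate moves the side lengths into them. *)
Lemma weighted_box_cover n (c : nat -> R) (a b : nat -> 'I_n -> R) :
  (forall k, 0 <= c k) ->
  (forall x : 'I_n -> R, (forall i, 0 < x i <= 1) ->
     (1 <= \sum_(k <oo) (c k * \prod_i ind (a k i) (b k i) (x i))%:E)%E) ->
  (1 <= \sum_(k <oo) (c k * \prod_i Num.max (b k i - a k i) 0)%:E)%E.
Proof.
elim: n c a b => [|n IHn] c a b c0 cover.
  have := cover (fun=> 1) (fun i => False_ind _ (notF (ltn_ord i))).
  by under eq_eseriesr do rewrite big_ord0;
     under [X in _ -> (_ <= X)%E]eq_eseriesr do rewrite big_ord0.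
under eq_eseriesr do rewrite big_ord_recl mulrA.
apply: (IHn _ (fun k j => a k (lift ord0 j)) (fun k j => b k (lift ord0 j))).
  by move=> k; rewrite mulr_ge0// le_max lexx orbT.
move=> x x01.
pose q k := \prod_i ind (a k (lift ord0 i)) (b k (lift ord0 i)) (x i) : R.
have q0 k : 0 <= q k by apply: prodr_ge0 => i _; exact: ler0n.
pose g k (t : measurableTypeR R) :=
  ((c k * q k)%:E * (ind (a k ord0) (b k ord0) t : R)%:E)%E.
have g0 k t : (0 <= g k t)%E by rewrite /g -EFinM lee_fin !mulr_ge0// ?ler0n.
pose e k : measurableTypeR R -> \bar R := fun t => (ind (a k ord0) (b k ord0) t : R)%:E.
have mI k : measurable_fun (`]0%R, 1%R]%classic : set (measurableTypeR R)) (e k).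
  have -> : e k = (fun t => (\1_(`]a k ord0, b k ord0]%classic : set R) t)%:E).
    apply/funext => t; rewrite indicE; congr (_%:R%:E).
    by rewrite mem_setE in_itv.
  by apply/measurable_EFinP; exact: measurable_indic.
have mg k :
    measurable_fun (`]0%R, 1%R]%classic : set (measurableTypeR R)) (g k).
  exact: (measurable_funeM (c k * q k)%:E (mI k)).
have one : (\int[lebesgue_measure]_(t in `]0%R, 1%R]) (cst 1%E t) = 1 :> \bar R)%E.
  rewrite integral_cst//= mul1e lebesgue_measure_itv/= lte_fin ltr01.
  by rewrite EFinN oppe0 adde0.
(* The left side becomes the integral of [1] over the unit interval of the first coordinate [t], so
   that the covering inequality at [(t, x)] can be integrated in [t] with [x] fixed. *)
rewrite -one.
have gle t : (`]0%R, 1%R]%classic : set R) t -> (1 <= \sum_(k <oo) g k t)%E.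
  rewrite /= in_itv/= => t01.
  have := cover (fun i => if unlift ord0 i is Some j then x j else t).
  have H : forall i : 'I_n.+1,
      0 < (if unlift ord0 i is Some j then x j else t) <= 1.
    by move=> i; case: (unlift ord0 i).
  move=> /(_ H) h; apply: (le_trans h); apply: lee_nneseries => [k _ _|k _].
    rewrite lee_fin mulr_ge0// prodr_ge0// => i _; exact: ler0n.
  rewrite big_ord_recl unlift_none; under eq_bigr do rewrite liftK.
  by rewrite /g /q -EFinM lee_fin [X in c k * X]mulrC mulrA.
apply: (@le_trans _ _
    (\int[lebesgue_measure]_(t in `]0%R, 1%R]) (\sum_(k <oo) g k t))%E).
  apply: ge0_le_integral => //=.
  exact: ge0_emeasurable_sum.
rewrite integral_nneseries//.
apply: lee_nneseries => [k _ _|k _].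
  by apply: integral_ge0 => t _; exact: g0.
rewrite ge0_integralZl_EFin//; [|exact: (mI k)|exact: mulr_ge0].
rewrite mulrAC [in leRHS]EFinM.
by apply: lee_wpmul2l; [rewrite lee_fin mulr_ge0|exact: integral_unit_itv_le].
Qed.

End BoxCovers.

Lemma ler_coord_norm {R : realType} m (x : 'rV[R]_m) i : `|x 0 i| <= `|x|.
Proof.
by rewrite [leRHS]/Num.norm /= mx_normrE; apply/bigmax_geP; right; exists (0, i).
Qed.

(** * Lebesgue outer measure: cubes, diagonal maps, open sets, bounded integrands *)

Section LebesgueOuter.
Context {R : realType} {n : nat}.
Local Notation V := 'rV[R]_n.+1.

(** Each point of the cube lies in a box of the cover, so the box indicators sum to at least [1]
    there: this is the hypothesis of [weighted_box_cover] with unit weights. *)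
Lemma lebesgue_outer_unit_box :
  (1 <= lebesgue_outer [set x : V | forall i, (0 < x 0 i <= 1)%R])%E.
Proof.
apply: le_ereal_inf_tmp => _ [B cover <-].
have := @weighted_box_cover R n.+1 (fun=> 1) (fun k i => (B k).1 0 i)
  (fun k i => (B k).2 0 i).
under [X in _ -> _ -> (_ <= X)%E]eq_eseriesr do rewrite mul1r.
apply => [k//|x x01].
have [|k _ /= Bx] := cover (\row_i x i).
  by move=> i; rewrite mxE.
have t0 j : (0 <=
    (1 * \prod_i (((B j).1 0 i < x i <= (B j).2 0 i)%R : bool)%:R)%:E :> \bar R)%E.
  by rewrite lee_fin mul1r prodr_ge0// => i _; exact: ler0n.
rewrite (nneseriesD1 (n := k) (fun j _ => t0 j))//.
apply: (@le_trans _ _ (1 + 0)%E); first by rewrite adde0.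
apply: leeD; last exact: nneseries_ge0.
rewrite lee_fin mul1r big1// => i _; have := Bx i; rewrite mxE => -> //.
Qed.

(** A cover of [F] pulls back under the diagonal affine map to a cover of [E] by boxes, since the
    factors [s i] are positive; every volume is divided by their product. *)
Lemma lebesgue_outer_diag_affine (s : 'I_n.+1 -> R) (b : V) (E F : set V) :
  (forall i, 0 < s i) ->
  (forall x, E x -> F (\row_i (s i * x 0 i + b 0 i))) ->
  ((\prod_i s i)%:E * lebesgue_outer E <= lebesgue_outer F)%E.
Proof.
move=> s0 EF.
apply: le_ereal_inf_tmp => _ [B cover <-].
pose B' k : V * V := (\row_i (((B k).1 0 i - b 0 i) / s i),
                      \row_i (((B k).2 0 i - b 0 i) / s i)).
have BB' k : box_volume (B k) = \prod_i s i * box_volume (B' k).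
  rewrite /box_volume -big_split; apply: eq_bigr => i _ /=.
  rewrite !mxE -mulrBl opprB addrA subrK mulrC.
  by rewrite maxr_pMl ?ltW// mul0r divfK ?gt_eqF// mulr0.
under eq_eseriesr do rewrite BB' EFinM.
rewrite nneseriesZl => [|k _]; last by rewrite lee_fin box_volume_ge0.
apply: lee_wpmul2l; first by rewrite lee_fin prodr_ge0// => i _; exact: ltW.
apply: ereal_inf_lbound; exists B' => // x Ex.
have [k _ /= Bk] := cover _ (EF x Ex); exists k => // i; have := Bk i.
by rewrite /= !mxE ltr_pdivrMr// ler_pdivlMr// ltrBlDr lerBrDr mulrC.
Qed.

Lemma lebesgue_outer_bounded (E : set V) :
  bounded_set E -> (lebesgue_outer E < +oo)%E.
Proof.
move=> /ex_strict_bound_gt0[M M0 EM].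
apply: (@le_lt_trans _ _ (box_volume (const_mx (- M) : V, const_mx M : V))%:E);
  last exact: ltey.
pose B (k : nat) : V * V := if k is 0 then (const_mx (- M), const_mx M) else (0, 0).
have B0 k : box_volume (B k.+1) = 0.
  by rewrite /box_volume big_ord_recl /= mxE subrr maxxx mul0r.
apply: ereal_inf_lbound; exists B; last first.
  rewrite (nneseriesD1 (n := 0%N))//=; last first.
    by move=> ? _; rewrite lee_fin box_volume_ge0.
  rewrite eseries0 ?adde0// => -[//|k] _ _; by rewrite B0.
move=> x /EM /= xM; exists 0%N => // i; rewrite /= !mxE.
have := le_lt_trans (ler_coord_norm x i) xM.
by rewrite ltr_norml => /andP[-> /ltW ->].
Qed.

(** A sup-norm ball of radius [r] contains the unit box scaled by [r / 2] and moved so that its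
    corner is the centre. *)
Lemma lebesgue_outer_open_gt0 (E : set V) :
  open E -> E !=set0 -> (0 < lebesgue_outer E)%E.
Proof.
move=> oE [p Ep].
have /nbhs_ballP[r /= r0 rE] : nbhs p E by exact: open_nbhs_nbhs.
apply: (@lt_le_trans _ _ ((\prod_(i < n.+1) (r / 2))%:E * 1)%E).
  by rewrite mule1 lte_fin prodr_gt0// => i _; rewrite divr_gt0.
apply: (@le_trans _ _ ((\prod_(i < n.+1) (r / 2))%:E *
   lebesgue_outer [set x : V | forall i, (0 < x 0%R i <= 1)%R])%E).
  apply: lee_wpmul2l; last exact: lebesgue_outer_unit_box.
  by rewrite lee_fin prodr_ge0// => i _; rewrite divr_ge0// ltW.
apply: (@lebesgue_outer_diag_affine _ p) => [i|x x01]; first by rewrite divr_gt0.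
apply: rE; split => // i j; rewrite ord1 /ball /= !mxE.
rewrite opprD addrCA subrr addr0 normrN.
have /andP[x0 x1] := x01 j.
by rewrite ger0_norm; nra.
Qed.

Import HBNNSimple.

(** The integral is a supremum over simple functions [h] below [f] on [E]. The set [F] where [h] is
    nonzero is measurable and lies in [E], and [h] is at most [L] times its indicator. *)
Lemma integral_le_bounded (E : set V) (f : V -> R) (L : R) :
  0 <= L -> (forall x, E x -> 0 <= f x <= L) ->
  (\int[lebesgueRn]_(x in E) (f x)%:E <= L%:E * lebesgue_outer E)%E.
Proof.
move=> L0 fL; rewrite ge0_integralE; last first.
  by move=> x /fL /andP[f0 _]; rewrite lee_fin.
apply: ge_ereal_sup => _ [h /= hf <-].
pose F := h @^-1` (~` [set 0]).
have mF : measurable F.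
  by rewrite -[F]setTI; apply: measurable_funPT => //; exact: measurableC.
have FE : F `<=` E.
  move=> x /= hx; apply: contrapT => Ex; apply: hx.
  have := hf x; rewrite patchE memNset// lee_fin => hx.
  by apply/eqP; rewrite eq_le hx/=; exact: fun_ge0.
apply: (@le_trans _ _ (L%:E * lebesgueRn F)%E); last first.
  by apply: lee_wpmul2l; [rewrite lee_fin|exact: le_lebesgue_outer].
rewrite -sintegral_indic// -(sintegralrM lebesgueRn L (indic_nnsfun R mF)).
apply: (@le_sintegral _ _ _ _ h (scale_nnsfun (indic_nnsfun R mF) L0)) => x.
rewrite -[leRHS]/(L * \1_F x) indicE.
have [Fx|nFx] := pselect (F x).
  rewrite mem_set// mulr1.
  have := hf x; rewrite patchE mem_set ?lee_fin; last exact: FE.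
  by move=> /le_trans; apply; have /andP[] := fL x (FE x Fx).
have -> : h x = 0 by exact: contrapT.
by rewrite mulr_ge0.
Qed.

End LebesgueOuter.

(** * Dot product and continuity of diagonal quadratics *)

Section DotProduct.
Context {R : realType} {n : nat}.
Implicit Types (p x y : 'rV[R]_n).

Lemma dotvDr p x y : dotv p (x + y) = dotv p x + dotv p y.
Proof. by rewrite /dotv -big_split; apply: eq_bigr => i _; rewrite mxE mulrDr. Qed.

Lemma dotvZr p t x : dotv p (t *: x) = t * dotv p x.
Proof. by rewrite /dotv mulr_sumr; apply: eq_bigr => i _; rewrite mxE mulrCA. Qed.

Lemma dotvC x y : dotv x y = dotv y x.
Proof. by apply: eq_bigr => i _; rewrite mulrC. Qed.

Lemma dotvDl p x y : dotv (x + y) p = dotv x p + dotv y p.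
Proof. by rewrite dotvC dotvDr !(dotvC p). Qed.

Lemma dotvZl p t x : dotv (t *: x) p = t * dotv x p.
Proof. by rewrite dotvC dotvZr dotvC. Qed.

Lemma dotvBr p x y : dotv p (x - y) = dotv p x - dotv p y.
Proof. by rewrite dotvDr -scaleN1r dotvZr mulN1r. Qed.

Lemma dotvNr p x : dotv p (- x) = - dotv p x.
Proof. by rewrite -scaleN1r dotvZr mulN1r. Qed.

Lemma dotvNl p x : dotv (- x) p = - dotv x p.
Proof. by rewrite dotvC dotvNr dotvC. Qed.

Lemma dotvBl p x y : dotv (x - y) p = dotv x p - dotv y p.
Proof. by rewrite dotvC dotvBr !(dotvC p). Qed.

Lemma dotv0 p : dotv p 0 = 0.
Proof. by rewrite /dotv big1// => i _; rewrite mxE mulr0. Qed.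

Lemma continuous_sum (I : finType) (F : I -> 'rV[R]_n -> R) :
  (forall i, continuous (F i)) -> continuous (fun x => \sum_i F i x).
Proof.
move=> cF; rewrite -[X in continuous X]fct_sumE.
apply: (big_ind (fun g : 'rV[R]_n -> R => continuous g)) => //.
  exact: cst_continuous.
by move=> f g cf cg x; exact: (continuousD (cf x) (cg x)).
Qed.

Lemma dotv_continuous p : continuous (dotv p : 'rV[R]_n -> R).
Proof.
apply: continuous_sum => i x.
by apply: continuousM; [exact: cst_continuous|exact: coord_continuous].
Qed.

Lemma diag_quadratic_continuous (d : 'I_n -> R) :
  continuous (fun x : 'rV[R]_n => \sum_i d i * x 0 i ^+ 2 : R).
Proof.
apply: continuous_sum => i x.
apply: (@continuousM _ _ (fun=> d i) (fun y : 'rV[R]_n => y 0 i ^+ 2)).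
  exact: cst_continuous.
apply: (@continuous_comp _ _ _ (fun y : 'rV[R]_n => y 0 i) (fun t => t ^+ 2)).
  exact: coord_continuous.
exact: exprn_continuous.
Qed.

End DotProduct.

(** * Convex combinations and short segments inside neighbourhoods *)

Section ConvexAccess.
Context {R : realType} {n : nat}.
Local Notation V := 'rV[R]_n.

Lemma convex_function_le (D : set V) (u : V -> R) x y (t : R) :
  convex_function D u -> D x -> D y -> 0 <= t <= 1 ->
  u (t *: x + (1 - t) *: y) <= t * u x + (1 - t) * u y.
Proof.
move=> cu Dx Dy /andP[t0 t1].
by have := cu (Itv01 t0 t1) x y (mem_set Dx) (mem_set Dy).
Qed.

Lemma convex_set_conv (D : set V) x y (t : R) :
  convex_set D -> D x -> D y -> 0 <= t <= 1 -> D (t *: x + (1 - t) *: y).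
Proof.
move=> cD Dx Dy /andP[t0 t1].
by have := cD x y (Itv01 t0 t1) (mem_set Dx) (mem_set Dy); rewrite inE.
Qed.

Lemma bounded_closure (A : set V) : bounded_set A -> bounded_set (closure A).
Proof.
move=> [M [Mr AM]]; exists M; split=> // r /AM Ar x /=.
have cB : closed [set y : V | `|y| <= r].
  apply: (@closed_comp _ _ (fun y : V => `|y|) [set s | s <= r]) => [y _|].
    exact: norm_continuous.
  exact: closed_le.
by rewrite closureE => /(_ [set y : V | `|y| <= r]); apply; split => // y /Ar.
Qed.

Lemma nbhs_segment (A : set V) (x y : V) : nbhs x A ->
  exists2 e : R, 0 < e <= 1 & forall t, 0 <= t <= e -> A (t *: y + (1 - t) *: x).
Proof.
move=> /nbhs_ballP[r /= r0 rA].
have s0 : 0 < r / (1 + `|y - x|) by rewrite divr_gt0// ltr_pwDl.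
exists (Num.min 1 (r / (1 + `|y - x|))).
  by rewrite lt_min ltr01 s0 ge_min lexx.
move=> t /andP[t0]; rewrite le_min => /andP[_ tr].
apply: rA; rewrite -ball_normE /=.
have -> : x - (t *: y + (1 - t) *: x) = - (t *: (y - x)).
  by apply/rowP => i; rewrite !mxE; ring.
rewrite normrN normrZ ger0_norm//.
move: tr; rewrite ler_pdivlMr ?ltr_pwDl// mulrDr mulr1.
have [->|tn0] := eqVneq t 0; first by rewrite mul0r.
have : 0 < t by rewrite lt_def tn0.
lra.
Qed.

End ConvexAccess.

(** * Comparison with quadratic polynomials *)

Section Comparison.
Context {R : realType} {n : nat}.
Local Notation V := 'rV[R]_n.+1.

(* If p is the gradient of v at a point of {u < v}, then u - p.y attains its
   minimum over closure D inside {u < v}. So the gradient image of {u < v}, of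
   volume det D^2 v times that of {u < v}, lies in the normal image of u. *)
Lemma comparison_quadratic (Omega D : set V) (u f : V -> R) (L : R)
    (d : 'I_n.+1 -> R) (b : V) (c : R)
    (v := fun x : V => \sum_i d i * x 0 i ^+ 2 + dotv b x + c) :
  open Omega -> bounded_set Omega -> open D -> D `<=` Omega ->
  convex_function (closure Omega) u ->
  {within closure Omega, continuous u} ->
  alexandrov_solution Omega f u ->
  0 <= L -> (forall x, Omega x -> 0 <= f x <= L) ->
  (forall i, 0 < d i) -> L < \prod_i (2 * d i) ->
  (forall x, closure D x -> ~ D x -> v x <= u x) ->
  forall x, D x -> v x <= u x.
Proof.
move=> oO bO oD DO cu ctu [_ MAu] L0 fL d0 Ld vuD x0 Dx0.
have v_cont : continuous v.
  move=> x; exact: (continuousD (continuousD (@diag_quadratic_continuous _ _ d x)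
    (@dotv_continuous _ _ b x)) (@cst_continuous _ _ c x)).
apply: contrapT => /negP; rewrite -ltNge => uv0.
pose E := [set x | D x /\ u x < v x].
have OclO : Omega `<=` closure Omega by exact: subset_closure.
have EO : E `<=` Omega by move=> x [/DO].
have u_cont x : Omega x -> u y @[y --> x] --> u x.
  move=> Ox; have /subspace_continuousP := ctu => /(_ x (OclO _ Ox)).
  rewrite within_interior//; apply: (interiorS OclO).
  by move: oO; rewrite openE => /(_ _ Ox).
have oE : open E.
  rewrite openE => x [Dx uvx]; apply: filterI.
    exact: open_nbhs_nbhs.
  have uv : (fun y => u y - v y) @ x --> u x - v x.
    exact: (@continuousB _ _ _ u v x (u_cont _ (DO _ Dx)) (v_cont x)).
  have : u x - v x < 0 by rewrite subr_lt0.
  move=> /(cvgr_lt _ uv); apply: filterS => y.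
  by rewrite subr_lt0.
have E0 : E !=set0 by exists x0.
have bE : bounded_set E 
  by case: bO => M [Mr OM]; exists M; split=> // r /OM Or x /EO /Or.
(* The volume of the normal image of [E] lies between the two sides: it is the integral of [f] over
   [E], and it is at least the volume of the image of [E] under the gradient of [v]. *)
have Eb : ((\prod_i (2 * d i))%:E * lebesgue_outer E <= L%:E * lebesgue_outer E)%E.
  apply: (@le_trans _ _ (lebesgue_outer (normal_image Omega u E))); last first.
    rewrite -[leLHS]/(monge_ampere_measure Omega u E) MAu//; last first.
      exact: sub_sigma_algebra.
    by apply: integral_le_bounded => // x /EO /fL.
  apply: (@lebesgue_outer_diag_affine _ _ _ b) => [i|x1 [Dx1 uvx1]].
    by rewrite mulr_gt0.
  set p := \row_i _.
  have v_above y : v x1 + dotv p (y - x1) <= v y.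
    rewrite -subr_ge0 [leRHS](_ : _ = \sum_i d i * (y 0 i - x1 0 i) ^+ 2).
      by apply: sumr_ge0 => i _; rewrite mulr_ge0 ?sqr_ge0// ltW.
    rewrite /v /dotv.
    transitivity (\sum_i d i * y 0 i ^+ 2 + \sum_i b 0 i * y 0 i
        - \sum_i d i * x1 0 i ^+ 2 - \sum_i b 0 i * x1 0 i
        - \sum_i p 0 i * (y - x1) 0 i); first by ring.
    rewrite -!sumrN -!big_split/=; apply: eq_bigr => i _.
    by rewrite !mxE; ring.
  have ctD : {within closure D, continuous (fun y => u y - dotv p y)}.
    have cu' := continuous_subspaceW (closureS DO) ctu.
    have cp : {within closure D, continuous (dotv p)}.
      by apply: continuous_subspaceT; exact: dotv_continuous.
    by move=> y; exact: (continuousB (cu' y) (cp y)).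
  have cD : compact (closure D).
    apply: bounded_closed_compact; last exact: closed_closure.
    apply: bounded_closure; case: bO => M [Mr OM]; exists M; split=> //.
    by move=> r /OM Or y /DO /Or.
  have [|x2 /[!inE] Dx2 x2min] := EVT_min_rV _ cD ctD.
    by exists x0; exact: subset_closure.
  have ux2 : u x2 < v x2.
    have := x2min x1; rewrite inE => /(_ (subset_closure Dx1)) => m1.
    have := v_above x2; rewrite dotvBr => m2.
    by lra.
  have {}Dx2 : D x2.
    by apply: contrapT => /(vuD _ Dx2); rewrite leNgt ux2.
  exists x2; first by split.
  move=> y Oy; rewrite dotvBr.
  have oDx : nbhs x2 D by exact: open_nbhs_nbhs.
  (* So far [p] supports [u] at [x2] only over [closure D]. Convexity extends this to any [y] in
     [Omega], because the segment from [x2] to [y] starts inside [D]. *)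
  have [t t0 Dt] : exists2 t : R, 0 < t <= 1 & D (t *: y + (1 - t) *: x2).
    have [e e01 De] := nbhs_segment y oDx; exists e => //; apply: De.
    by have /andP[/ltW -> _] := e01; rewrite lexx.
  have := x2min _ (mem_set (subset_closure Dt)).
  have := convex_function_le cu (OclO _ Oy) (OclO _ (DO _ Dx2)).
  move=> /(_ t); rewrite dotvDr !dotvZr => h1 h2.
  have {}h1 : u (t *: y + (1 - t) *: x2) <= t * u y + (1 - t) * u x2.
    by apply: h1; have /andP[/ltW -> ->] := t0.
  by have /andP[tgt0 _] := t0; nra.
(* The outer measure of [E] is positive and finite, so it cancels from [Eb], which then contradicts
   [Ld]. *)
have Egt0 := lebesgue_outer_open_gt0 oE E0.
have Efin : lebesgue_outer E \is a fin_num.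
  by rewrite ge0_fin_numE ?ltW// lebesgue_outer_bounded.
move: Eb Egt0; rewrite -(fineK Efin) -!EFinM lte_fin lee_fin => Eb E0'.
by move: Eb; rewrite ler_pM2r// leNgt Ld.
Qed.

End Comparison.

(** * Horizontal and vertical components of a point *)

Section HorizontalVertical.
Context {R : realType} {n : nat}.
Local Notation V := 'rV[R]_n.+1.
Implicit Types x y : V.

Definition vertical : V := delta_mx 0 ord_max.
Definition hnorm x : R := enorm (xinit x).

Lemma xlastD x y : xlast (x + y) = xlast x + xlast y.
Proof. by rewrite /xlast mxE. Qed.

Lemma xlastZ t x : xlast (t *: x) = t * xlast x.
Proof. by rewrite /xlast mxE. Qed.

Lemma xlastN x : xlast (- x) = - xlast x.
Proof. by rewrite /xlast mxE. Qed.

Lemma xlast_vertical : xlast vertical = 1.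
Proof. by rewrite /xlast mxE !eqxx. Qed.

Lemma xinitD x y : xinit (x + y) = xinit x + xinit y.
Proof. by apply/rowP => i; rewrite !mxE. Qed.

Lemma xinitZ t x : xinit (t *: x) = t *: xinit x.
Proof. by apply/rowP => i; rewrite !mxE. Qed.

Lemma xinitN x : xinit (- x) = - xinit x.
Proof. by apply/rowP => i; rewrite !mxE. Qed.

Lemma xinit_vertical : xinit vertical = 0.
Proof. by apply/rowP => i; rewrite !mxE eqxx/= -val_eqE/= ltn_eqF. Qed.

Lemma dotv_xinit_xlast x y :
  dotv x y = dotv (xinit x) (xinit y) + xlast x * xlast y.
Proof.
by rewrite /dotv big_ord_recr/=; congr (_ + _); apply: eq_bigr => i _; rewrite !mxE.
Qed.

Lemma dotvv_ge0 m (x : 'rV[R]_m) : 0 <= dotv x x.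
Proof. by apply: sumr_ge0 => i _; rewrite -expr2 sqr_ge0. Qed.

Lemma enorm_ge0 m (x : 'rV[R]_m) : 0 <= enorm x.
Proof. exact: sqrtr_ge0. Qed.

Lemma sqr_enorm m (x : 'rV[R]_m) : enorm x ^+ 2 = dotv x x.
Proof. by rewrite sqr_sqrtr// dotvv_ge0. Qed.

Lemma enormZ m t (x : 'rV[R]_m) : enorm (t *: x) = `|t| * enorm x.
Proof.
by rewrite /enorm dotvZl dotvZr mulrA -expr2 sqrtrM ?sqr_ge0// sqrtr_sqr.
Qed.

Lemma ler_coord_enorm m (x : 'rV[R]_m) i : `|x 0 i| <= enorm x.
Proof.
rewrite -(@ler_pXn2r _ 2)// ?nnegrE// ?enorm_ge0// sqr_enorm real_normK ?num_real//.
rewrite /dotv (bigD1 i)//= -expr2 lerDl.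
by apply: sumr_ge0 => j _; rewrite -expr2 sqr_ge0.
Qed.

Lemma ler_norm_enorm m (x : 'rV[R]_m) : `|x| <= enorm x.
Proof.
rewrite [leLHS]/Num.norm /= mx_normrE; apply/bigmax_leP; split.
  exact: enorm_ge0.
by move=> [i j] _ /=; rewrite ord1 ler_coord_enorm.
Qed.

Lemma hnorm_ge0 x : 0 <= hnorm x. Proof. exact: enorm_ge0. Qed.

Lemma hnormZ t x : hnorm (t *: x) = `|t| * hnorm x.
Proof. by rewrite /hnorm xinitZ enormZ. Qed.

Lemma hnorm_vert x t : hnorm (x + t *: vertical) = hnorm x.
Proof. by rewrite /hnorm xinitD xinitZ xinit_vertical scaler0 addr0. Qed.

Lemma hnorm_vertB x t : hnorm (x - t *: vertical) = hnorm x.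
Proof. by rewrite -scaleNr hnorm_vert. Qed.

Lemma hnormN x : hnorm (- x) = hnorm x.
Proof. by rewrite -scaleN1r hnormZ normrN1 mul1r. Qed.

Lemma sqr_enorm_split x : enorm x ^+ 2 = hnorm x ^+ 2 + xlast x ^+ 2.
Proof. by rewrite !sqr_enorm dotv_xinit_xlast -expr2. Qed.

Lemma xlast_le_enorm x : xlast x <= enorm x.
Proof. exact: le_trans (ler_norm _) (ler_coord_enorm _ _). Qed.

Lemma hnorm_le_enorm x : hnorm x <= enorm x.
Proof.
rewrite -(@ler_pXn2r _ 2)// ?nnegrE ?hnorm_ge0 ?enorm_ge0//.
by rewrite sqr_enorm_split lerDl sqr_ge0.
Qed.

Lemma enorm_horizontal x : xlast x = 0 -> enorm x = hnorm x.
Proof. by move=> x0; rewrite /enorm dotv_xinit_xlast x0 mulr0 addr0. Qed.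

Lemma enorm_eq0 m (x : 'rV[R]_m) : enorm x = 0 -> x = 0.
Proof.
move=> x0; apply/rowP => i; rewrite mxE; apply/eqP.
by rewrite -normr_eq0 eq_le normr_ge0 andbT -x0 ler_coord_enorm.
Qed.

Lemma horizontal_part x : xlast (x - xlast x *: vertical) = 0.
Proof. by rewrite xlastD -scaleNr xlastZ xlast_vertical mulr1 subrr. Qed.

(** The assumption that the dimension is at least 2 enters the argument through this lemma. *)
Lemma horizontal_unit : (0 < n)%N -> exists e : V, xlast e = 0 /\ hnorm e = 1.
Proof.
move=> n0; exists (delta_mx 0 (widen_ord (leqnSn n) (Ordinal n0))).
have e0 : xlast (delta_mx 0 (widen_ord (leqnSn n) (Ordinal n0)) : V) = 0.
  by rewrite /xlast mxE eqxx/= -val_eqE/= gtn_eqF.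
split=> //; rewrite -enorm_horizontal// /enorm /dotv.
rewrite (bigD1 (widen_ord (leqnSn n) (Ordinal n0)))//= big1 => [|j jn].
  by rewrite mxE !eqxx mulr1 addr0 sqrtr1.
by rewrite mxE (negbTE jn) andbF mulr0.
Qed.

End HorizontalVertical.
Arguments vertical {R n}.

(** * Exit points of rays, and segments in open convex sets *)

Section OpenSets.
Context {R : realType} {n : nat}.
Local Notation V := 'rV[R]_n.
Implicit Types (Omega : set V) (x y z w : V).

Lemma bdry_notin Omega x : open Omega ->
  bdry Omega x <-> closure Omega x /\ ~ Omega x.
Proof.
rewrite openE /bdry => oO; split=> -[cx nx]; split => // /[dup] Ox.
  by move/oO.
by move/interior_subset.
Qed.

Lemma nbhs_ray (A : set V) x w : nbhs x A ->
  exists2 e : R, 0 < e <= 1 & forall t, 0 <= t <= e -> A (x + t *: w).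
Proof.
move=> /(nbhs_segment (x + w))[e e01 eA]; exists e => // t /eA.
by rewrite scalerDr addrAC -scalerDl subrKC scale1r.
Qed.

(** The exit time is the supremum of the times in [[0, 1]] at which the moving point is in [Omega].
    The point reached is a limit of points of [Omega]; if it were inside, openness would allow a
    later time. *)
Lemma exit_point Omega z w : open Omega -> Omega z -> ~ Omega (z + w) ->
  exists s : R, 0 < s <= 1 /\ bdry Omega (z + s *: w).
Proof.
move=> oO Oz Ow.
have ray x v : Omega x -> exists2 e : R, 0 < e <= 1 &
    forall t, 0 <= t <= e -> Omega (x + t *: v).
  by move=> Ox; apply: nbhs_ray; exact: open_nbhs_nbhs.
pose S := [set s : R | 0 <= s <= 1 /\ Omega (z + s *: w)].
have S0 : S 0 by split; rewrite ?lexx ?ler01// scale0r addr0.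
have S1 : ubound S 1 by move=> s [/andP[]].
have supS : has_sup S by split; [exists 0|exists 1].
have s01 : 0 <= sup S <= 1.
  by rewrite ub_le_sup//=; [apply: ge_sup => //; exists 0|exists 1].
exists (sup S); split.
  have /andP[_ ->] := s01; rewrite andbT.
  have [e /andP[e0 e1] eO] := ray z w Oz.
  apply: (lt_le_trans e0); apply: ub_le_sup; first by exists 1.
  by split; rewrite ?(ltW e0)//; apply: eO; rewrite ltW//= lexx.
apply/bdry_notin => //; split.
  move=> B /(nbhs_ray (- w))[e /andP[e0 e1] eB].
  have [s Ss es] := sup_adherent e0 supS.
  exists (z + s *: w); split; first by case: Ss.
  have := eB (sup S - s).
  rewrite scalerN -addrA -scalerBl subKr; apply.
  by rewrite subr_ge0 (ub_le_sup _ Ss)//=; [lra|exists 1].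
move=> Os.
have s1 : sup S < 1.
  rewrite lt_neqAle; have /andP[_ ->] := s01; rewrite andbT.
  by apply/eqP => s1; apply: Ow; rewrite -(scale1r w) -s1.
have [e /andP[e0 e1] eO] := ray _ w Os.
pose t := Num.min e (1 - sup S).
have t0 : 0 < t by rewrite lt_min e0 subr_gt0.
suff : S (sup S + t).
  by move=> /(ub_le_sup (ex_intro _ 1 S1)); rewrite gerDl leNgt t0.
split; last by rewrite scalerDl addrA; apply: eO; rewrite ltW//= ge_min lexx.
have : t <= 1 - sup S by rewrite ge_min lexx orbT.
by move: s01 => /andP[]; lra.
Qed.

Lemma exit_point_ray Omega z w : open Omega -> bounded_set Omega -> Omega z ->
  w != 0 -> exists s : R, 0 < s /\ bdry Omega (z + s *: w).
Proof.
move=> oO /ex_strict_bound_gt0[M M0 OM] Oz w0.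
have [T T0 nT] : exists2 T : R, 0 < T & ~ Omega (z + T *: w).
  exists (2 * M / `|w|); first by rewrite !mulr_gt0// invr_gt0 normr_gt0.
  move=> /OM /=; apply/negP; rewrite -leNgt.
  rewrite addrC; have := lerB_normD ((2 * M / `|w|) *: w) z.
  rewrite normrZ ger0_norm ?divfK ?normr_eq0//; last first.
    by rewrite divr_ge0// mulr_ge0// ltW.
  have /= := OM _ Oz; lra.
have [s [/andP[s0 _] bs]] := exit_point oO Oz nT.
by exists (s * T); split; [exact: mulr_gt0|rewrite -scalerA].
Qed.

(** Since [x] is only in the closure, it is replaced by a point [y] of [Omega] within [t * r].
    Moving [z] by [(1 - t) / t] times [x - y] compensates and stays in the ball of radius [r] around
    [z]. *)
Lemma convex_open_segment Omega x z (t : R) : open Omega -> convex_set Omega ->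
  closure Omega x -> Omega z -> 0 < t <= 1 -> Omega (t *: z + (1 - t) *: x).
Proof.
move=> oO cO cx Oz /andP[t0 t1].
have /nbhs_ballP[r /= r0 rO] : nbhs z Omega by exact: open_nbhs_nbhs.
have [y [Oy yx]] : Omega `&` ball x (t * r) !=set0.
  by apply: cx; apply: nbhsx_ballx; exact: mulr_gt0.
have -> : t *: z + (1 - t) *: x =
    t *: (z + ((1 - t) / t) *: (x - y)) + (1 - t) *: y.
  rewrite scalerDr scalerA mulrCA divff ?gt_eqF// mulr1 scalerBr.
  by rewrite addrA subrK.
apply: convex_set_conv => //; last by rewrite ltW.
apply: rO; move: yx; rewrite -!ball_normE /= => yx.
rewrite opprD addrA subrr add0r normrN normrZ ger0_norm; last first.
  by rewrite divr_ge0 ?subr_ge0// ltW.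
rewrite mulrAC ltr_pdivrMr//.
apply: (@le_lt_trans _ _ `|x - y|); last by rewrite mulrC.
by rewrite ler_piMl//; lra.
Qed.

End OpenSets.

(** * Geometry of the boundary near the origin *)

Section BoundaryGeometry.
Context {R : realType} {n : nat}.
Local Notation V := 'rV[R]_n.+1.
Context (Omega : set V) (oO : open Omega) (bO : bounded_set Omega).
Context (cO : convex_set Omega) (cl0 : closure Omega 0).
Context (OH : Omega `<=` @half_space R n) (n0 : (0 < n)%N).
Context (kappa : R) (k0 : 0 < kappa).
Context (kO : forall x, bdry Omega x -> kappa * enorm x ^+ 2 <= xlast x).

(** The point leaves [Omega] in two opposite horizontal directions. As the height is constant on the
    chord, bounds in terms of [xlast] pass from the boundary to the interior. *)
Lemma horizontal_chord x : Omega x -> exists (y z : V) (t : R),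
  [/\ bdry Omega y, bdry Omega z, xlast y = xlast x, xlast z = xlast x &
      0 <= t <= 1 /\ x = t *: y + (1 - t) *: z].
Proof.
move=> Ox; have [e [eh e1]] := @horizontal_unit R n n0.
have e0 : e != 0.
  apply/eqP => e0; move: e1 => /eqP.
  by rewrite e0 -(scale0r 0) hnormZ normr0 mul0r eq_sym oner_eq0.
have [s [s0 bs]] := exit_point_ray oO bO Ox e0.
have ne0 : - e != 0 by rewrite oppr_eq0.
have [s' [s'0 bs']] := exit_point_ray oO bO Ox ne0.
have ss0 : 0 < s + s' by exact: addr_gt0.
exists (x + s *: e), (x + s' *: (- e)), (s' / (s + s')); split => //.
- by rewrite xlastD xlastZ eh mulr0 addr0.
- by rewrite xlastD xlastZ -scaleN1r xlastZ eh !mulr0 addr0.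
split.
  by rewrite ler_pdivrMr// mul1r lerDr (ltW s0) andbT divr_ge0// ltW.
apply/rowP => i; rewrite !mxE; field.
by rewrite gt_eqF.
Qed.

(** On a horizontal chord the right side is constant and the left side is convex, so the values at
    the two boundary ends control the interior. *)
Lemma closure_kappa x : closure Omega x -> kappa * enorm x ^+ 2 <= xlast x.
Proof.
move=> cx; have [Ox|nOx] := pselect (Omega x); last exact/kO/bdry_notin.
have [y [z [t [/kO ky /kO kz yx zx [/andP[t0 t1] xE]]]]] := horizontal_chord Ox.
have -> : enorm x ^+ 2 = t * enorm y ^+ 2 + (1 - t) * enorm z ^+ 2 -
    t * (1 - t) * enorm (y - z) ^+ 2.
  rewrite xE !sqr_enorm !(dotvBl, dotvBr) !(dotvDr, dotvDl, dotvZl, dotvZr).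
  by rewrite (dotvC z y); ring.
have := sqr_ge0 (enorm (y - z)); rewrite {}yx in ky; rewrite {}zx in kz.
move=> yz0; have t10 : 0 <= 1 - t by rewrite subr_ge0.
have h1 := ler_wpM2l t0 ky; have h2 := ler_wpM2l t10 kz.
have h3 : 0 <= kappa * (t * (1 - t) * enorm (y - z) ^+ 2).
  by apply: mulr_ge0; [exact: ltW|apply: mulr_ge0 => //; exact: mulr_ge0].
nra.
Qed.

Lemma segment0 z t : Omega z -> 0 < t <= 1 -> Omega (t *: z).
Proof.
by move=> Oz t01; have := convex_open_segment oO cO cl0 Oz t01; rewrite scaler0 addr0.
Qed.

Context (b : V) (C r : R) (bh : xlast b = 0) (C0 : 0 < C) (r0 : 0 < r).
Context (graph : forall x, bdry Omega x -> enorm x < r ->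
  `|xlast x - dotv b x| <= C * hnorm x ^+ 2).

Lemma dotv_b_vertical : dotv b (vertical : V) = 0.
Proof. by rewrite dotv_xinit_xlast xinit_vertical dotv0 bh mul0r addr0. Qed.

Lemma bdry_small x : bdry Omega x -> xlast x < kappa * r ^+ 2 -> enorm x < r.
Proof.
move=> /kO kx xr; rewrite -(@ltr_pXn2r _ 2)// ?nnegrE ?enorm_ge0 ?ltW//.
by rewrite -(ltr_pM2l k0); exact: le_lt_trans xr.
Qed.

(** Suppose the axis misses [Omega], and let [z] and [z - eta *: vertical] be in [Omega], with [h]
    the horizontal part of [z] and [B = dotv b h]. Leaving [Omega] from [s *: z] towards the axis
    gives [xlast z <= B] up to [O(s)]; leaving it downwards from the lower point scaled by [s] gives
    [B <= xlast z - eta] up to [O(s)]. These are incompatible for small [s]. *)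
Lemma vertical_mem : exists2 t, 0 < t & Omega (t *: vertical).
Proof.
apply: contrapT => noV.
have {}noV t : 0 < t -> ~ Omega (t *: vertical) by move=> t0 Ot; apply: noV; exists t.
have [z [Oz _]] : Omega `&` setT !=set0 by apply: cl0; exact: filterT.
have [eta /andP[eta0 _] etaO] := nbhs_ray (- vertical) (open_nbhs_nbhs (conj oO Oz)).
have := etaO eta; rewrite lexx ltW// => /(_ isT); rewrite scalerN => Oz2.
pose h := z - xlast z *: vertical.
have hh : xlast h = 0 := horizontal_part z.
have zh : z = h + xlast z *: vertical by rewrite subrK.
have z0 : 0 < xlast z := OH Oz.
have z20 := OH Oz2.
rewrite /half_space /= xlastD -scaleNr xlastZ xlast_vertical mulr1 in z20.
(* The three bounds keep the scaled points in [Omega], place the exit points where [graph] applies,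
   and make twice the quadratic error, divided by [s], smaller than the gap [eta]. *)
pose s := Num.min 1 (Num.min (kappa * r ^+ 2 / (xlast z + xlast z))
   (eta / (C * hnorm h ^+ 2 + 1) / 2)).
have D0 : 0 < C * hnorm h ^+ 2 + 1.
  by rewrite ltr_wpDl// mulr_ge0 ?sqr_ge0// ltW.
have s0 : 0 < s.
  rewrite !lt_min ltr01/= !divr_gt0//; first by rewrite mulr_gt0// exprn_gt0.
  exact: addr_gt0.
have s1 : s <= 1 by rewrite ge_min lexx.
have sr : s * xlast z < kappa * r ^+ 2.
  have : s <= kappa * r ^+ 2 / (xlast z + xlast z) by rewrite !ge_min lexx !orbT.
  rewrite ler_pdivlMr ?addr_gt0// mulrDr => h1.
  by have := mulr_gt0 s0 z0; lra.
have sC : s * (C * hnorm h ^+ 2) * 2 < eta.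
  have : s <= eta / (C * hnorm h ^+ 2 + 1) / 2 by rewrite !ge_min lexx !orbT.
  by rewrite ler_pdivlMr// ler_pdivlMr// mulrDr; lra.
have Osz : Omega (s *: z) by apply: segment0; rewrite ?s0.
have Osz2 : Omega (s *: (z - eta *: vertical)) by apply: segment0; rewrite ?s0.
have [|sg [/andP[sg0 sg1] bsg]] := exit_point (w := - (s *: h)) oO Osz.
  rewrite {1}zh scalerDr addrAC subrr add0r scalerA; apply: noV.
  exact: mulr_gt0.
set y := _ + _ in bsg.
have yE : y = ((1 - sg) * s) *: h + (s * xlast z) *: vertical.
  rewrite /y {1}zh; apply/rowP => i; rewrite !mxE; ring.
(* Going straight down must leave [Omega] at height [0] at the latest, because [Omega] lies in the
   open half-space. *)
have [|sg2 [/andP[sg20 sg21] bsg2]] :=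
    exit_point (w := - ((s * (xlast z - eta)) *: vertical)) oO Osz2.
  move=> /OH; rewrite /half_space /= !(xlastD, xlastN, xlastZ) xlast_vertical.
  by rewrite !mulr1 subrr ltxx.
set y2 := _ + _ in bsg2.
have y2E : y2 = s *: h + ((1 - sg2) * s * (xlast z - eta)) *: vertical.
  rewrite /y2 {1}zh; apply/rowP => i; rewrite !mxE; ring.
have yl : xlast y = s * xlast z.
  by rewrite yE xlastD !xlastZ hh xlast_vertical mulr0 add0r mulr1.
have y2l : xlast y2 = (1 - sg2) * s * (xlast z - eta).
  by rewrite y2E xlastD !xlastZ hh xlast_vertical mulr0 add0r mulr1.
have := graph bsg (bdry_small bsg _); rewrite yl => /(_ sr).
have y2le : xlast y2 <= s * (xlast z - eta).
  by rewrite y2l -mulrA ler_piMl//; [rewrite mulr_ge0// ltW|lra].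
have := graph bsg2 (bdry_small bsg2 _) => /(_ _).
have sz2 : s * (xlast z - eta) < s * xlast z by rewrite ltr_pM2l//; lra.
move=> /(_ (lt_trans (le_lt_trans y2le sz2) sr)).
rewrite y2E yE !hnorm_vert !hnormZ !dotvDr !dotvZr dotv_b_vertical !mulr0 !addr0.
rewrite -y2E !exprMn !real_normK ?num_real//.
set B := dotv b h; set H := hnorm h in sC *.
rewrite !ler_norml => /andP[g2 _] /andP[_ g1].
have H0 : 0 <= C * H ^+ 2 by rewrite mulr_ge0 ?sqr_ge0// ltW.
pose k := s * (C * H ^+ 2).
have k_ge0 : 0 <= k by rewrite mulr_ge0// ltW.
have {}g2 : B <= xlast z - eta + k by rewrite -(ler_pM2l s0) /k; lra.
have {}g1 : xlast z <= (1 - sg) * B + (1 - sg) ^+ 2 * k.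
  by rewrite -(ler_pM2l s0) /k; lra.
have sgk : (1 - sg) ^+ 2 * k <= k by rewrite ler_piMl// exprn_ile1//; lra.
have kE : k * 2 < eta by [].
have B0 : 0 < (1 - sg) * B by lra.
have sg1' : 0 <= 1 - sg by lra.
have Bgt0 : 0 < B.
  by rewrite ltNge; apply/negP => /(mulr_ge0_le0 sg1'); lra.
have : (1 - sg) * B <= B by rewrite ler_piMl ?ltW//; lra.
lra.
Qed.

Lemma vertical_mem_small : exists2 t0, 0 < t0 &
  forall t, 0 < t <= t0 -> Omega (t *: vertical).
Proof.
have [t0 t00 Ot0] := vertical_mem; exists t0 => // t /andP[tgt0 tt0].
have := @segment0 _ (t / t0) Ot0; rewrite scalerA divfK ?gt_eqF//; apply.
by rewrite divr_gt0//= ler_pdivrMr// mul1r.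
Qed.

(** From [(0, t)] go horizontally in the direction [- b]. At the exit point the linear term is
    [- s |b|^2], so [graph] forces [C s >= 1], whereas uniform convexity forces
    [kappa s^2 |b|^2 <= t], with [t] as small as desired. *)
Lemma linear_part_eq0 : b = 0.
Proof.
have [t0 t00 Ot0] := vertical_mem_small.
apply/eqP; apply: contrapT => /negP b0.
have B0 : 0 < dotv b b.
  rewrite lt_def dotvv_ge0 andbT -sqr_enorm sqrf_eq0.
  by apply/negP => /eqP /enorm_eq0 /eqP; exact/negP.
have bb : hnorm b ^+ 2 = dotv b b.
  by rewrite /hnorm sqr_enorm dotv_xinit_xlast bh mul0r addr0.
pose t := Num.min t0 (Num.min (kappa * r ^+ 2 / 2) (kappa * dotv b b / C ^+ 2 / 2)).
have rr0 : 0 < kappa * r ^+ 2 by rewrite mulr_gt0// exprn_gt0.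
have t_gt0 : 0 < t.
  rewrite !lt_min t00/=; apply/andP; split; first by apply: divr_gt0.
  by apply: divr_gt0 => //; apply: divr_gt0; [exact: mulr_gt0|exact: exprn_gt0].
have tt0 : t <= t0 by rewrite ge_min lexx.
have tr : t <= kappa * r ^+ 2 / 2 by rewrite !ge_min lexx !orbT.
have tC : t * C ^+ 2 * 2 <= kappa * dotv b b.
  have : t <= kappa * dotv b b / C ^+ 2 / 2 by rewrite !ge_min lexx !orbT.
  by rewrite ler_pdivlMr// ler_pdivlMr ?exprn_gt0//; lra.
have nb0 : - b != 0 by rewrite oppr_eq0.
have [|s [s0 bs]] := exit_point_ray oO bO (Ot0 t _) nb0; first by rewrite t_gt0.
have tl : xlast (t *: vertical + s *: (- b)) = t.
  by rewrite xlastD !(xlastZ, xlastN) bh xlast_vertical oppr0 mulr0 addr0 mulr1.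
have th : hnorm (t *: vertical + s *: (- b)) ^+ 2 = s ^+ 2 * dotv b b.
  by rewrite addrC hnorm_vert hnormZ /hnorm xinitN exprMn real_normK ?num_real//
    sqr_enorm !(dotvNl, dotvNr) opprK -bb /hnorm sqr_enorm.
have := kO bs; rewrite sqr_enorm_split th tl => h1.
have := graph bs (bdry_small bs _); rewrite tl th => /(_ _).
rewrite dotvDr !dotvZr dotv_b_vertical dotvNr mulr0 add0r => h2.
have {h2} := h2 ltac:(lra); rewrite ler_norml => /andP[_ h2].
have h3 : 1 <= C * s.
  have : s * dotv b b * 1 <= s * dotv b b * (C * s) by lra.
  by rewrite ler_pM2l// mulr_gt0.
have h4 : kappa * (s ^+ 2 * dotv b b) <= t.
  by apply: le_trans h1; rewrite ler_pM2l// lerDl sqr_ge0.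
have h5 : 1 <= (C * s) ^+ 2 by rewrite exprn_ege1.
have kB : 0 < kappa * dotv b b by exact: mulr_gt0.
have : kappa * dotv b b * (C * s) ^+ 2 * 2 <= kappa * dotv b b.
  apply: le_trans tC; rewrite ler_pM2r// exprMn.
  rewrite [leLHS](_ : _ = kappa * (s ^+ 2 * dotv b b) * C ^+ 2); last by ring.
  by rewrite ler_pM2r// exprn_gt0.
nra.
Qed.

(** Seen from the axis, the slice at height [t] has radius comparable to the square root of [t] in
    every direction: uniform convexity bounds it above, and the graph, now without linear part,
    bounds it below. *)
Lemma slice_exit : exists2 t0, 0 < t0 & forall t, 0 < t <= t0 ->
  Omega (t *: vertical) /\ forall e, xlast e = 0 -> hnorm e = 1 ->
  exists s, [/\ 0 < s, bdry Omega (t *: vertical + s *: e),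
    kappa * s ^+ 2 <= t & t <= C * s ^+ 2].
Proof.
have [t1 t10 Ot1] := vertical_mem_small.
have rr0 : 0 < kappa * r ^+ 2 by rewrite mulr_gt0// exprn_gt0.
exists (Num.min t1 (kappa * r ^+ 2 / 2)); first by rewrite lt_min t10 divr_gt0.
move=> t; rewrite le_min => /and3P[t_gt0 tt1 tr].
have Ot : Omega (t *: vertical) by apply: Ot1; rewrite t_gt0.
split=> // e eh e1.
have e_neq0 : e != 0.
  apply/eqP => e0; move: e1 => /eqP.
  by rewrite e0 -(scale0r 0) hnormZ normr0 mul0r eq_sym oner_eq0.
have [s [s0 bs]] := exit_point_ray oO bO Ot e_neq0.
have tl : xlast (t *: vertical + s *: e) = t.
  by rewrite xlastD !xlastZ eh xlast_vertical mulr0 addr0 mulr1.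
have th : hnorm (t *: vertical + s *: e) ^+ 2 = s ^+ 2.
  by rewrite addrC hnorm_vert hnormZ e1 mulr1 real_normK ?num_real.
exists s; split => //.
  have := kO bs; rewrite sqr_enorm_split th tl; apply: le_trans.
  by rewrite ler_pM2l// lerDl sqr_ge0.
have := graph bs (bdry_small bs _); rewrite tl th => /(_ _).
rewrite linear_part_eq0 dotvC dotv0 subr0 => /(_ ltac:(lra)).
by rewrite ger0_norm// ltW.
Qed.

End BoundaryGeometry.

(** * Inequalities between real powers *)

Section PowerBounds.
Context {R : realType}.
Implicit Types a b s x y p q : R.

Lemma powR_exp_le x p q : 0 <= x <= 1 -> 0 < p -> p <= q -> x `^ q <= x `^ p.
Proof.
move=> /andP[x0 x1] p0 pq; have [->|xn0] := eqVneq x 0.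
  by rewrite !powR0 ?gt_eqF//; exact: lt_le_trans pq.
by apply: ger_powR; rewrite // x1 lt_def xn0 x0.
Qed.

Lemma powR_base_le x y p : 0 <= p -> 0 <= x -> x <= y -> x `^ p <= y `^ p.
Proof.
by move=> p0 x0 xy; apply: ge0_ler_powR => //; rewrite nnegrE//; exact: le_trans xy.
Qed.

Lemma powR_small (C e p : R) : 0 <= C -> 0 < e -> 0 < p ->
  exists2 r, 0 < r & forall s, 0 <= s <= r -> C * s `^ p <= e.
Proof.
move=> C0 e0 p0; have C1 : 0 < C + 1 by lra.
exists ((e / (C + 1)) `^ p^-1); first by rewrite powR_gt0// divr_gt0.
move=> s /andP[s0 sr].
have : s `^ p <= e / (C + 1).
  apply: le_trans (powR_base_le (ltW p0) s0 sr) _.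
  by rewrite -powRrM mulVf ?gt_eqF// powRr1// divr_ge0// ltW.
rewrite ler_pdivlMr// => h; have := powR_ge0 s p; nra.
Qed.

Lemma powR_2D s p : 0 <= s -> 0 < p -> s `^ (2 + p) = s ^+ 2 * s `^ p.
Proof.
by move=> s0 p0; rewrite powRD ?powR_mulrn// gt_eqF// addr_gt0.
Qed.

Lemma powR_1D s p : 0 <= s -> 0 < p -> s `^ (1 + p) = s * s `^ p.
Proof.
by move=> s0 p0; rewrite powRD ?powRr1// gt_eqF// addr_gt0.
Qed.

End PowerBounds.

(** * Growth of the normalized function [w] near the origin *)

Section Growth.
Context {R : realType} {n : nat}.
Local Notation V := 'rV[R]_n.+1.
Context (Omega : set V) (kappa C t0 : R) (k0 : 0 < kappa) (C0 : 0 < C) (t00 : 0 < t0).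
Context (kO : forall x, closure Omega x -> kappa * enorm x ^+ 2 <= xlast x).
Context (slice : forall t, 0 < t <= t0 ->
  Omega (t *: vertical) /\ forall e : V, xlast e = 0 -> hnorm e = 1 ->
  exists s, [/\ 0 < s, bdry Omega (t *: vertical + s *: e),
    kappa * s ^+ 2 <= t & t <= C * s ^+ 2]).
Context (w : V -> R) (K : R) (K0 : 0 <= K).
Context (wc : convex_function (closure Omega) w) (w0 : w 0 = 0).
Context (w_ge0 : forall x, closure Omega x -> 0 <= w x).
Context (wK : forall x, closure Omega x -> w x <= K * xlast x).

Lemma closure_bdry x : bdry Omega x -> closure Omega x. Proof. by case. Qed.

(** A point [x] at height [t] lies between [(0, t)] and a boundary point at horizontal distance [s],
    with weight [hnorm x / s] on the latter, where [w <= K t]. Since [t / s] is of order at most the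
    square root of [t], the boundary contributes [O(|x|^(3/2))]; this is why [delta] is at most
    [1 / 2]. *)
Lemma growth_from_vertical (delta A t1 : R) : 0 < delta <= 1 / 2 -> 0 < t1 ->
  0 <= A -> (forall t, 0 < t <= t1 -> w (t *: vertical) <= A * t `^ (1 + delta)) ->
  exists2 A', 0 <= A' & exists2 r', 0 < r' & forall x, closure Omega x ->
    enorm x < r' -> w x <= A' * enorm x `^ (1 + delta).
Proof.
move=> /andP[d0 d12] t10 A0 wv.
pose M := Num.sqrt C.
have M0 : 0 <= M by exact: sqrtr_ge0.
(* [A] pays for the axis, [K * M] for the boundary end of the segment, and [K * C] for the case
   [s < hnorm x]. *)
exists (A + K * M + K * C); first by rewrite !addr_ge0// mulr_ge0// ltW.
exists (Num.min 1 (Num.min t0 t1)); first by rewrite !lt_min ltr01 t00.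
move=> x cx; rewrite !lt_min => /and3P[x1 xt0 xt1].
have x01 : 0 <= enorm x <= 1 by rewrite enorm_ge0 ltW.
have N0 : 0 <= enorm x := enorm_ge0 x.
have tx := xlast_le_enorm x.
have kx := kO cx.
set t := xlast x in kx tx *.
have t_ge0 : 0 <= t by apply: le_trans kx; rewrite mulr_ge0 ?sqr_ge0// ltW.
have P0 : 0 <= enorm x `^ (1 + delta) by exact: powR_ge0.
have AKC : 0 <= (A + K * M + K * C) * enorm x `^ (1 + delta).
  by rewrite mulr_ge0// !addr_ge0// mulr_ge0// ltW.
have [tE|tn0] := eqVneq t 0.
  have : enorm x ^+ 2 <= 0 by rewrite -(pmulr_rle0 _ k0) -tE.
  rewrite le_eqVlt ltNge sqr_ge0 orbF sqrf_eq0 => /eqP /enorm_eq0 ->.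
  by rewrite w0 mulr_ge0 ?powR_ge0// !addr_ge0// mulr_ge0// ltW.
have t_gt0 : 0 < t by rewrite lt_def tn0.
have tt0 : 0 < t <= t0 by rewrite t_gt0/= (le_trans tx)// ltW.
have tt1 : 0 < t <= t1 by rewrite t_gt0/= (le_trans tx)// ltW.
have [Otv sl] := slice tt0.
have wtv : w (t *: vertical) <= A * enorm x `^ (1 + delta).
  apply: le_trans (wv _ tt1) _; apply: ler_wpM2l => //.
  by apply: powR_base_le => //; rewrite ltW// ltr_wpDl.
have [rho0|rhon0] := eqVneq (hnorm x) 0.
  have hx : x - t *: vertical = 0.
    by apply: enorm_eq0; rewrite enorm_horizontal ?horizontal_part// hnorm_vertB.
  move: wtv; rewrite -{1}(subr0_eq hx) => /le_trans; apply.
  by apply: ler_wpM2r => //; rewrite -addrA lerDl addr_ge0// mulr_ge0// ltW.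
have rho_gt0 : 0 < hnorm x by rewrite lt_def rhon0 hnorm_ge0.
have rhoN := hnorm_le_enorm x.
pose e := (hnorm x)^-1 *: (x - t *: vertical).
have eh : xlast e = 0 by rewrite xlastZ horizontal_part mulr0.
have e1 : hnorm e = 1.
  by rewrite hnormZ hnorm_vertB ger0_norm ?invr_ge0 ?hnorm_ge0// mulVf.
have eE : hnorm x *: e = x - t *: vertical by rewrite scalerA divff// scale1r.
clearbody e.
have [s [s0 bs ks sC]] := sl e eh e1.
have cs := closure_bdry bs.
have wKs : w (t *: vertical + s *: e) <= K * t.
  have := wK cs; rewrite xlastD !xlastZ eh xlast_vertical mulr0 addr0 mulr1.
  exact.
(* When [s < hnorm x], the bound [t <= C s^2 <= C |x|^2] makes [w <= K t] already small enough. *)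
have [rs|sr] := leP (hnorm x) s; last first.
  have e2 : enorm x ^+ 2 <= enorm x `^ (1 + delta).
    by rewrite -powR_mulrn// powR_exp_le//; lra.
  apply: (le_trans (wK cx)).
  have : K * t <= K * C * enorm x `^ (1 + delta).
    rewrite -mulrA; apply: ler_wpM2l => //; apply: (le_trans sC).
    apply: ler_wpM2l; first exact: ltW.
    apply: le_trans e2; rewrite ler_pXn2r ?nnegrE//; last exact: ltW.
    exact: le_trans (ltW sr) rhoN.
  move=> /le_trans; apply; apply: ler_wpM2r => //.
  by rewrite lerDr addr_ge0// mulr_ge0.
have th01 : 0 <= hnorm x / s <= 1.
  by rewrite ler_pdivrMr// mul1r rs andbT divr_ge0// ltW.
have xE : x = (hnorm x / s) *: (t *: vertical + s *: e) +
   (1 - hnorm x / s) *: (t *: vertical).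
  rewrite scalerDr addrAC -scalerDl subrKC scale1r scalerA.
  by rewrite divfK ?gt_eqF// eE subrKC.
have cv : closure Omega (t *: vertical) by exact: subset_closure.
have := convex_function_le wc cs cv th01; rewrite -xE => /le_trans; apply.
have ts : t / s <= M * Num.sqrt (enorm x).
  rewrite -sqrtrM ?(ltW C0)//.
  rewrite -(@ler_pXn2r _ 2)// ?nnegrE ?sqrtr_ge0//; last by rewrite divr_ge0// ltW.
  rewrite sqr_sqrtr; last by rewrite mulr_ge0// ltW.
  rewrite expr_div_n ler_pdivrMr ?exprn_gt0//.
  have h1 : t * t <= C * s ^+ 2 * enorm x.
    by apply: ler_pM => //; apply: le_trans sC.
  lra.
have sqN : enorm x * Num.sqrt (enorm x) <= enorm x `^ (1 + delta).
  rewrite -powR12_sqrt// -powR_1D//.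
  by apply: powR_exp_le => //; lra.
have wv0 := w_ge0 cv.
have h1 : (1 - hnorm x / s) * w (t *: vertical) <= w (t *: vertical).
  by rewrite ler_piMl//; case/andP: th01; lra.
have h2 : hnorm x / s * w (t *: vertical + s *: e) <= K * M * (enorm x `^ (1 + delta)).
  apply: (@le_trans _ _ (hnorm x / s * (K * t))).
    by apply: ler_wpM2l => //; case/andP: th01.
  apply: (@le_trans _ _ (K * M * (enorm x * Num.sqrt (enorm x)))); last first.
    by apply: ler_wpM2l => //; exact: mulr_ge0.
  rewrite [leLHS](_ : _ = K * (hnorm x * (t / s))); last by ring.
  rewrite [leRHS](_ : _ = K * (enorm x * (M * Num.sqrt (enorm x)))); last by ring.
  by apply: ler_wpM2l => //; apply: ler_pM; rewrite ?hnorm_ge0// divr_ge0// ltW.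
have KC0 : 0 <= K * C * enorm x `^ (1 + delta) by rewrite !mulr_ge0// ltW.
lra.
Qed.

(* At the two boundary points (+-s e, t) the data is O(t^(1 + alpha/2)), and
   (0, t) lies between them. *)
Lemma vertical_growth_degenerate (P : V -> R) (alpha C2 r2 : R) (e : V) :
  0 < alpha -> 0 <= C2 -> 0 < r2 ->
  (forall x t, P (x + t *: vertical) = P x) ->
  (forall t x, P (t *: x) = t ^+ 2 * P x) ->
  (forall x, bdry Omega x -> xlast x < r2 ->
     `|w x - P x| <= C2 * hnorm x `^ (2 + alpha)) ->
  xlast e = 0 -> hnorm e = 1 -> P e = 0 ->
  exists2 A, 0 <= A & exists2 t1, 0 < t1 &
    forall t, 0 < t <= t1 -> w (t *: vertical) <= A * t `^ (1 + alpha / 2).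
Proof.
move=> a0 C20 r20 Pv P2 wP eh e1 Pe.
(* From [kappa s^2 <= t], the error [s^(2 + alpha)] is at most [(t / kappa)^(1 + alpha / 2)]. *)
exists (C2 * kappa^-1 `^ (1 + alpha / 2)); first by rewrite mulr_ge0// powR_ge0.
exists (Num.min t0 (r2 / 2)); first by rewrite lt_min t00 divr_gt0.
move=> t; rewrite le_min => /and3P[t_gt0 tt0 tr].
have [Ot sl] := slice (introT andP (conj t_gt0 tt0)).
have side e' : xlast e' = 0 -> hnorm e' = 1 -> P e' = 0 ->
    exists2 s, 0 < s & closure Omega (t *: vertical + s *: e') /\
      w (t *: vertical + s *: e') <=
        C2 * kappa^-1 `^ (1 + alpha / 2) * t `^ (1 + alpha / 2).
  move=> eh' e1' Pe'; have [s [s0 bs ks sC]] := sl e' eh' e1'.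
  exists s => //; split; first exact: closure_bdry.
  have := wP _ bs; rewrite xlastD !xlastZ eh' xlast_vertical mulr0 addr0 mulr1.
  rewrite (addrC (t *: _)) hnorm_vert Pv P2 Pe' mulr0 subr0.
  move=> /(_ ltac:(lra)).
  rewrite hnormZ e1' mulr1 (ger0_norm (ltW s0)).
  move=> /(le_trans (ler_norm _)) /le_trans; apply.
  rewrite -mulrA; apply: ler_wpM2l => //.
  rewrite -powRM ?invr_ge0 ?(ltW k0) ?(ltW t_gt0)//.
  rewrite [2 + alpha](_ : _ = 2 * (1 + alpha / 2)); last by field.
  rewrite powRrM powR_mulrn; last exact: ltW.
  apply: powR_base_le; rewrite ?sqr_ge0//; first by rewrite addr_ge0// divr_ge0// ltW.
  by rewrite ler_pdivlMl.
have [s s0 [cs ws]] := side e eh e1 Pe.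
have [|||s' s'0 [cs' ws']] := side (- e).
- by rewrite xlastN eh oppr0.
- by rewrite hnormN.
- by rewrite -scaleN1r P2 Pe mulr0.
have ss0 : 0 < s + s' by exact: addr_gt0.
have th01 : 0 <= s' / (s + s') <= 1.
  by rewrite ler_pdivrMr// mul1r lerDr (ltW s0) andbT divr_ge0// ltW.
have := convex_function_le wc cs cs' th01.
rewrite (_ : _ + _ *: (_ + s' *: _) = t *: vertical); last first.
  by apply/rowP => i; rewrite !mxE; field; rewrite gt_eqF.
move=> /le_trans; apply; case/andP: th01 => h0 h1.
have h1' : 0 <= 1 - s' / (s + s') by rewrite subr_ge0.
by have := ler_wpM2l h0 ws; have := ler_wpM2l h1' ws'; lra.
Qed.

(** Close to [0] the error of order [2 + alpha] uses up at most half of [m |x'|^2], and the other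
    half dominates a multiple of [xlast x] by the graph bound. *)
Lemma boundary_lower_bound (P : V -> R) (alpha C2 r2 m : R) :
  0 < alpha -> 0 <= C2 -> 0 < r2 -> 0 < m ->
  (forall x, bdry Omega x -> xlast x < r2 -> xlast x <= C * hnorm x ^+ 2) ->
  (forall x, m * hnorm x ^+ 2 <= P x) ->
  (forall x, bdry Omega x -> xlast x < r2 ->
     `|w x - P x| <= C2 * hnorm x `^ (2 + alpha)) ->
  exists2 c1, 0 < c1 & exists2 r3, 0 < r3 & forall x, bdry Omega x ->
    xlast x < r3 -> c1 * xlast x <= w x.
Proof.
move=> a0 C20 r20 m0 xC Pm wP.
have m2 : 0 < m / 2 by exact: divr_gt0.
have [r r0 rs] := powR_small C20 m2 a0.
exists (m / 2 / C); first by rewrite divr_gt0.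
exists (Num.min r2 (kappa * r ^+ 2)).
  by rewrite lt_min r20 mulr_gt0// exprn_gt0.
move=> x bx; rewrite lt_min => /andP[xr2 xr].
have hr : hnorm x <= r.
  rewrite -(@ler_pXn2r _ 2)// ?nnegrE ?hnorm_ge0 ?(ltW r0)//.
  rewrite -(ler_pM2l k0); apply: le_trans (ltW xr).
  apply: le_trans (kO (closure_bdry bx)); rewrite ler_pM2l//.
  by rewrite sqr_enorm_split lerDl sqr_ge0.
have := wP _ bx xr2; rewrite powR_2D ?hnorm_ge0// ler_norml => /andP[wl _].
have h0 := sqr_ge0 (hnorm x).
have := rs _ (introT andP (conj (hnorm_ge0 x) hr)) => h1.
have h2 := ler_wpM2r h0 h1.
have h3 := xC _ bx xr2.
have h4 := Pm x.
apply: (@le_trans _ _ (m / 2 * hnorm x ^+ 2)); last by lra.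
by rewrite -[leLHS]mulrA ler_pM2l// ler_pdivrMl.
Qed.

Context (L : R) (L0 : 0 <= L).
Context (cmp : forall (D : set V) (A B a : R), open D -> D `<=` Omega ->
  0 < A -> 0 < B -> L < (2 * A) ^+ n * (2 * B) ->
  (forall x, closure D x -> ~ D x ->
    A * hnorm x ^+ 2 + B * xlast x ^+ 2 + a * xlast x <= w x) ->
  forall x, D x -> A * hnorm x ^+ 2 + B * xlast x ^+ 2 + a * xlast x <= w x).
Context (w_inf : forall e, 0 < e -> exists2 x, Omega x & w x < e * xlast x).
Context (oO : open Omega) (cO : convex_set Omega) (cl0 : closure Omega 0).
Context (OH : Omega `<=` @half_space R n).

(* If w >= e x_n above height T = tau e^(n+1), the quadratic
   (e/2) x_n + (kappa e/4) |x'|^2 + (e/4T) x_n^2 is a lower barrier below it,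
   which contradicts the vanishing of the infimum of w / x_n. *)
Lemma contact_height (c1 r3 : R) : 0 < c1 -> 0 < r3 ->
  (forall x, bdry Omega x -> xlast x < r3 -> c1 * xlast x <= w x) ->
  exists2 tau, 0 < tau & exists2 e0, 0 < e0 <= 1 & forall e, 0 < e <= e0 ->
    exists x, [/\ Omega x, tau * e ^+ n.+1 <= xlast x & w x <= e * xlast x].
Proof.
move=> c10 r30 wlow.
have k20 : 0 < (kappa / 2) ^+ n by rewrite exprn_gt0// divr_gt0.
(* This value gives the barrier Hessian determinant exactly [L + 1], just enough for the
   comparison. *)
pose tau := (kappa / 2) ^+ n / (2 * (L + 1)).
have L1 : 0 < L + 1 by rewrite ltr_wpDl.
have tau0 : 0 < tau by apply: divr_gt0 => //; exact: mulr_gt0.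
have tauE : (kappa / 2) ^+ n = tau * (2 * (L + 1)).
  by rewrite divfK// gt_eqF// mulr_gt0.
clearbody tau; exists tau => //.
(* With [e <= c1] the boundary bound gives [w >= e x_n]; the other two bounds put the height [T]
   below [r3], where that bound is available. *)
pose e0 := Num.min 1 (Num.min c1 (r3 / (2 * tau))).
exists e0.
  rewrite !lt_min ltr01 c10 ge_min lexx/= andbT.
  by apply: divr_gt0 => //; exact: mulr_gt0.
move=> e /andP[e_gt0]; rewrite !le_min => /and3P[e1 ec er].
set T := tau * e ^+ n.+1.
have T0 : 0 < T by rewrite mulr_gt0// exprn_gt0.
have TE : T = tau * e ^+ n.+1 by [].
clearbody T.
have Tr : T < r3.
  have : T <= tau * e.
    by rewrite TE ler_pM2l// exprS ler_piMr ?exprn_ile1 ?(ltW e_gt0).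
  by move: er; rewrite ler_pdivlMr ?mulr_gt0//; lra.
apply: contrapT => contact.
have wT x : Omega x -> T <= xlast x -> e * xlast x < w x.
  by move=> Ox Tx; rewrite ltNge; apply/negP => wx; apply: contact; exists x.
pose D := Omega `&` [set x | xlast x < T].
have xc : continuous (@xlast R n) by move=> x; exact: coord_continuous.
have oD : open D.
  apply: openI => //; apply: (@open_comp _ _ (@xlast R n) [set t | t < T]).
    by move=> ? _; exact: xc.
  exact: open_lt.
have DT : closure D `<=` [set x | xlast x <= T].
  have cT : closed [set x : V | xlast x <= T].
    apply: (@closed_comp _ _ (@xlast R n) [set t | t <= T]); last exact: closed_le.
    by move=> ? _; exact: xc.
  rewrite closureE => x; apply; split => // y [_ /= yT]; exact: ltW.
have Dlow := @cmp D (kappa * e / 4) (e / (4 * T)) (e / 2) oD.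
have {}Dlow : forall x, D x -> e / 2 * xlast x <= w x.
  move=> x Dx; have Ox : Omega x by case: Dx.
  have A0 : 0 < kappa * e / 4 by rewrite divr_gt0// mulr_gt0.
  have B0 : 0 < e / (4 * T) by rewrite divr_gt0// mulr_gt0.
  apply: le_trans (Dlow _ A0 B0 _ _ x Dx).
  - by rewrite lerDr addr_ge0// mulr_ge0 ?sqr_ge0// ltW.
  - by move=> y [].
  - rewrite [ltRHS](_ : _ = L + 1); first by lra.
    rewrite [2 * (kappa * e / 4)](_ : _ = kappa / 2 * e); last by field.
    rewrite exprMn tauE TE exprS; field.
    by rewrite !gt_eqF// exprn_gt0.
  (* Off [D], [w >= e x_n] holds both on the boundary of [Omega] and on the top face. Each of the
     two quadratic terms of the barrier is at most a quarter of [e x_n], and the linear term is half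
     of it. *)
  - move=> y cy nDy; have yT := DT _ cy.
    have cOy : closure Omega y by move: cy; apply: closureS => z [].
    have y0 : 0 <= xlast y by apply: le_trans (kO cOy); rewrite mulr_ge0 ?sqr_ge0// ltW.
    have wy : e * xlast y <= w y.
      have [Oy|nOy] := pselect (Omega y).
        apply/ltW/wT => //; rewrite leNgt; apply/negP => yltT.
        by apply: nDy; split.
      have by' : bdry Omega y by exact/bdry_notin.
      by apply: le_trans (wlow _ by' (le_lt_trans yT Tr)); exact: ler_wpM2r.
    have hy : kappa * hnorm y ^+ 2 <= xlast y.
      apply: le_trans (kO cOy); rewrite ler_pM2l//.
      by rewrite sqr_enorm_split lerDl sqr_ge0.
    have h1 : kappa * e / 4 * hnorm y ^+ 2 <= e / 4 * xlast y.
      rewrite [leLHS](_ : _ = e / 4 * (kappa * hnorm y ^+ 2)); last by field.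
      by rewrite ler_pM2l// divr_gt0.
    have h2 : e / (4 * T) * xlast y ^+ 2 <= e / 4 * xlast y.
      rewrite [leLHS](_ : _ = e / 4 * xlast y * (xlast y / T)); last by field; rewrite gt_eqF.
      by rewrite ler_piMr// ?ler_pdivrMr ?mul1r// mulr_ge0// divr_ge0// ltW.
    by lra.
have e20 : 0 < e / 2 by exact: divr_gt0.
have [x Ox] := w_inf e20; apply/negP; rewrite -leNgt.
have [xT|Tx] := ltP (xlast x) T; first by apply: Dlow.
have := wT _ Ox Tx; have := OH Ox; rewrite /half_space /= => x0 wx.
nra.
Qed.

Lemma vertical_growth_nondegenerate (c1 r3 : R) : 0 < c1 -> 0 < r3 ->
  (forall x, bdry Omega x -> xlast x < r3 -> c1 * xlast x <= w x) ->
  exists2 A, 0 <= A & exists2 t1, 0 < t1 &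
    forall t, 0 < t <= t1 -> w (t *: vertical) <= A * t `^ (1 + n.+3%:R^-1).
Proof.
move=> c10 r30 wlow.
have [tau tau0 [e0 /andP[e00 e01] contact]] := contact_height c10 r30 wlow.
pose del : R := n.+3%:R^-1.
have del0 : 0 < del by rewrite invr_gt0.
(* [M] compares the largest and smallest possible radii of a slice. *)
pose M := Num.sqrt (C / kappa).
have M0 : 0 <= M by exact: sqrtr_ge0.
have tdel0 : 0 <= tau^-1 `^ del by exact: powR_ge0.
exists ((1 + M * K) * tau^-1 `^ del).
  by rewrite mulr_ge0// addr_ge0// mulr_ge0.
exists (Num.min t0 (tau * e0 ^+ n.+3)).
  by rewrite lt_min t00 mulr_gt0// exprn_gt0.
move=> s; rewrite le_min => /and3P[s0 st0 se].
(* [e] solves [tau e^(n+3) = s], so that [s] is [e^2] times the least contact height [tau e^(n+1)].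
   This equation produces the exponent [1 / (n + 3)]. *)
pose e := (tau^-1 * s) `^ del.
have ts0 : 0 < tau^-1 * s by rewrite mulr_gt0// invr_gt0.
have e_gt0 : 0 < e by exact: powR_gt0.
have en : e ^+ n.+3 = tau^-1 * s.
  by rewrite -powR_mulrn ?(ltW e_gt0)// -powRrM mulVf// powRr1// ltW.
have ee0 : e <= e0.
  by rewrite -(@ler_pXn2r _ n.+3)// ?nnegrE ?(ltW e_gt0) ?(ltW e00)// en ler_pdivrMl.
have e1 : e <= 1 by exact: le_trans e01.
have sE : s = e ^+ 2 * (tau * e ^+ n.+1).
  rewrite mulrCA -exprD addSn addSn add0n en mulrA divff ?gt_eqF// mul1r //.
have [x [Ox xT wx]] := contact _ (introT andP (conj e_gt0 ee0)).
set t := xlast x in xT wx.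
have T0 : 0 < tau * e ^+ n.+1 by rewrite mulr_gt0// exprn_gt0.
have t_gt0 : 0 < t by exact: lt_le_trans xT.
have st : s <= e ^+ 2 * t by rewrite sE ler_pM2l// exprn_gt0.
have st1 : 0 <= s / t <= 1.
  rewrite divr_ge0 ?(ltW s0) ?(ltW t_gt0)//= ler_pdivrMr// mul1r.
  by apply: le_trans st _; rewrite ler_piMl ?(ltW t_gt0)// exprn_ile1// ltW.
have cx : closure Omega x by exact: subset_closure.
have [Osv sl] := slice (introT andP (conj s0 st0)).
have csv : closure Omega (s *: vertical) by exact: subset_closure.
(* Shrinking the contact point towards [0], where [w] vanishes, preserves [w <= e x_n] by convexity.
   Its horizontal size becomes at most [e] times the square root of [s / kappa], a factor [e] below
   the scale of the slice radius. *)
pose z := (s / t) *: x.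
have cz : closure Omega z.
  apply: subset_closure; apply: segment0 => //.
  by rewrite divr_gt0//; case/andP: st1.
have zl : xlast z = s by rewrite xlastZ divfK// gt_eqF.
have wz : w z <= e * s.
  have := convex_function_le wc cx cl0 st1; rewrite scaler0 addr0 w0 mulr0 addr0.
  move=> /le_trans; apply; rewrite mulrAC ler_pdivrMr//.
  by rewrite [leRHS](_ : _ = s * (e * t)); [rewrite ler_pM2l|ring].
have zk : kappa * hnorm z ^+ 2 <= s * e ^+ 2.
  rewrite hnormZ exprMn real_normK ?num_real//.
  have xk : kappa * hnorm x ^+ 2 <= t.
    apply: le_trans (kO cx); rewrite ler_pM2l//.
    by rewrite sqr_enorm_split lerDl sqr_ge0.
  rewrite mulrCA; apply: (@le_trans _ _ ((s / t) ^+ 2 * t)).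
    by apply: ler_wpM2l; rewrite ?sqr_ge0.
  rewrite [leLHS](_ : _ = s * (s / t)); last by field; rewrite gt_eqF.
  by rewrite ler_pM2l// ler_pdivrMr.
have sdel : e * s = tau^-1 `^ del * s `^ (1 + del).
  by rewrite /e powRM ?invr_ge0 ?(ltW s0) ?(ltW tau0)// powR_1D ?(ltW s0)//; ring.
have goal : w (s *: vertical) <= (1 + M * K) * (e * s); last first.
  by rewrite -mulrA -sdel.
have es0 : 0 <= e * s by rewrite mulr_ge0// ltW.
have [rho0|rhon0] := eqVneq (hnorm z) 0.
  have hz : z - xlast z *: vertical = 0.
    by apply: enorm_eq0; rewrite enorm_horizontal ?horizontal_part// hnorm_vertB.
  rewrite -zl -(subr0_eq hz) zl (le_trans wz)//.
  by rewrite ler_peMl// lerDl mulr_ge0.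
have rho_gt0 : 0 < hnorm z by rewrite lt_def rhon0 hnorm_ge0.
(* [d] points from [z] to the axis, so [(0, s)] lies between [z] and the exit point on the far
   side. *)
pose d := (hnorm z)^-1 *: (- (z - s *: vertical)).
have dh : xlast d = 0 by rewrite xlastZ xlastN -zl horizontal_part oppr0 mulr0.
have d1 : hnorm d = 1.
  by rewrite hnormZ hnormN hnorm_vertB ger0_norm ?invr_ge0 ?hnorm_ge0// mulVf.
have dE : d = (hnorm z)^-1 *: (- (z - s *: vertical)) by [].
clearbody d; have [sg [sg0 bsg _ sC]] := sl d dh d1.
have csg := closure_bdry bsg.
have wKs : w (s *: vertical + sg *: d) <= K * s.
  have := wK csg; rewrite xlastD !xlastZ dh xlast_vertical mulr0 addr0 mulr1.
  exact.
have rs0 : 0 < hnorm z + sg by exact: addr_gt0.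
have th01 : 0 <= sg / (hnorm z + sg) <= 1.
  by rewrite ler_pdivrMr// mul1r lerDr (ltW rho_gt0) andbT divr_ge0// ltW.
have svE : s *: vertical = (sg / (hnorm z + sg)) *: z +
    (1 - sg / (hnorm z + sg)) *: (s *: vertical + sg *: d).
  rewrite dE; apply/rowP => i; rewrite !mxE; field.
  by rewrite rhon0 !gt_eqF.
rewrite [leLHS](_ : _ = w ((sg / (hnorm z + sg)) *: z +
    (1 - sg / (hnorm z + sg)) *: (s *: vertical + sg *: d))); last by rewrite -svE.
apply: le_trans (convex_function_le wc cz csg th01) _.
have rM : hnorm z <= M * e * sg.
  rewrite -(@ler_pXn2r _ 2)// ?nnegrE ?hnorm_ge0 ?mulr_ge0 ?(ltW e_gt0) ?(ltW sg0)//.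
  rewrite !exprMn [M ^+ 2]sqr_sqrtr; last by rewrite divr_ge0// ltW.
  rewrite -(ler_pM2l k0); apply: (le_trans zk).
  rewrite [leRHS](_ : _ = C * sg ^+ 2 * e ^+ 2); last by field; rewrite gt_eqF.
  by rewrite ler_pM2r// exprn_gt0.
(* The far end carries a weight of order [e] only, so even the crude value [K s] there costs
   [O(e s)]. *)
have h1 : 1 - sg / (hnorm z + sg) <= M * e.
  have -> : 1 - sg / (hnorm z + sg) = hnorm z / (hnorm z + sg).
    by field; rewrite gt_eqF.
  rewrite ler_pdivrMr//; apply: (le_trans rM); apply: ler_wpM2l.
    by rewrite mulr_ge0// ltW.
  by rewrite lerDr ltW.
case/andP: th01 => th0 th1.
have h2 : (1 - sg / (hnorm z + sg)) * w (s *: vertical + sg *: d) <= M * e * (K * s).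
  by apply: ler_pM => //; [rewrite subr_ge0|exact: w_ge0].
have h3 : sg / (hnorm z + sg) * w z <= e * s.
  by apply: le_trans wz; rewrite ler_piMl// w_ge0.
by lra.
Qed.

End Growth.

(** * Decomposition of quadratic polynomials in [x'] *)

Section HorizontalQuadratic.
Context {R : realType} {n : nat}.
Local Notation V := 'rV[R]_n.+1.

(** Stands for a quadratic form in [x'], viewed as a function on the whole space and described by
    properties stable under linear combinations instead of by a matrix. *)
Definition horizontal_quadratic (Q : V -> R) : Prop :=
  [/\ forall x t, Q (x + t *: vertical) = Q x,
      forall t x, Q (t *: x) = t ^+ 2 * Q x,
      continuous Q &
      exists2 K, 0 <= K & forall x, `|Q x| <= K * hnorm x ^+ 2].

Lemma horizontal_quadratic0 : horizontal_quadratic (fun=> 0).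
Proof.
split=> // [t x|x|]; first by rewrite mulr0.
  exact: cst_continuous.
by exists 0 => // x; rewrite normr0 mul0r.
Qed.

Lemma horizontal_quadraticD Q1 Q2 : horizontal_quadratic Q1 ->
  horizontal_quadratic Q2 -> horizontal_quadratic (fun x => Q1 x + Q2 x).
Proof.
move=> [v1 h1 c1 [K1 K10 b1]] [v2 h2 c2 [K2 K20 b2]]; split.
- by move=> x t; rewrite v1 v2.
- by move=> t x; rewrite h1 h2 mulrDr.
- by move=> x; exact: (continuousD (c1 x) (c2 x)).
exists (K1 + K2) => [|x]; first exact: addr_ge0.
by rewrite mulrDl (le_trans (ler_normD _ _))// lerD.
Qed.

Lemma horizontal_quadraticZ a Q : horizontal_quadratic Q ->
  horizontal_quadratic (fun x => a * Q x).
Proof.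
move=> [v h c [K K0 b]]; split.
- by move=> x t; rewrite v.
- by move=> t x; rewrite h mulrCA.
- by move=> x; exact: (continuousM (@cst_continuous _ _ a x) (c x)).
exists (`|a| * K) => [|x]; first exact: mulr_ge0.
by rewrite normrM -mulrA ler_wpM2l.
Qed.

Lemma xinit_vert (x : V) t : xinit (x + t *: vertical) = xinit x.
Proof. by rewrite xinitD xinitZ xinit_vertical scaler0 addr0. Qed.

Lemma xinitE (x : V) i : xinit x 0 i = x 0 (widen_ord (leqnSn n) i).
Proof. by rewrite mxE. Qed.

Lemma horizontal_quadraticM i j :
  horizontal_quadratic (fun x => xinit x 0 i * xinit x 0 j).
Proof.
split.
- by move=> x t; rewrite xinit_vert.
- by move=> t x; rewrite xinitZ !mxE; ring.
- under eq_fun do rewrite !xinitE.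
  by move=> x; apply: continuousM; exact: coord_continuous.
exists 1 => // x; rewrite mul1r normrM expr2.
by apply: ler_pM => //; exact: ler_coord_enorm.
Qed.

Let quadratic_split (g : V -> R) : Prop := exists c b Q,
  [/\ xlast b = 0, horizontal_quadratic Q & forall x, g x = c + dotv b x + Q x].

Let quadratic_splitD g1 g2 : quadratic_split g1 -> quadratic_split g2 ->
  quadratic_split (fun x => g1 x + g2 x).
Proof.
move=> [c1 [b1 [Q1 [l1 q1 e1]]]] [c2 [b2 [Q2 [l2 q2 e2]]]].
exists (c1 + c2), (b1 + b2), (fun x => Q1 x + Q2 x); split.
- by rewrite xlastD l1 l2 addr0.
- exact: horizontal_quadraticD.
- by move=> x; rewrite e1 e2 dotvDl; ring.
Qed.

Let quadratic_splitZ a g : quadratic_split g -> quadratic_split (fun x => a * g x).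
Proof.
move=> [c [b [Q [l q e]]]].
exists (a * c), (a *: b), (fun x => a * Q x); split.
- by rewrite xlastZ l mulr0.
- exact: horizontal_quadraticZ.
- by move=> x; rewrite e dotvZl; ring.
Qed.

Let quadratic_split1 : quadratic_split (fun=> 1).
Proof.
exists 1, 0, (fun=> 0); split; first by rewrite /xlast mxE.
  exact: horizontal_quadratic0.
by move=> x; rewrite dotvC dotv0 !addr0.
Qed.

Let quadratic_splitX i : quadratic_split (fun x => xinit x 0 i).
Proof.
exists 0, (delta_mx 0 (widen_ord (leqnSn n) i)), (fun=> 0); split.
- by rewrite /xlast mxE eqxx/= -val_eqE/= gtn_eqF.
- exact: horizontal_quadratic0.
move=> x; rewrite add0r addr0 /dotv (bigD1 (widen_ord (leqnSn n) i))//= big1.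
  by rewrite !mxE !eqxx mul1r addr0.
by move=> j ji; rewrite mxE (negbTE ji) andbF mul0r.
Qed.

Lemma mnm_split (m : multinom n) : (0 < mdeg m)%N ->
  exists i m', m = mnm_add (mnm1 i) m'.
Proof.
rewrite lt0n mdeg_eq0 => m0.
have [i mi] : exists i, m i != 0%N.
  apply: contrapT => nm; move/eqP: m0; apply; apply/mnmP => i.
  by rewrite mnm0E; apply: contrapT => /eqP mi; apply: nm; exists i.
exists i, (mnm_sub m (mnm1 i)).
by rewrite addmC submK// lep1mP.
Qed.

Lemma prod_mnmD (x : 'I_n -> R) i (m : multinom n) :
  \prod_j x j ^+ mnm_add (mnm1 i) m j = x i * \prod_j x j ^+ m j.
Proof.
under eq_bigr do rewrite mnmDE exprD.
rewrite big_split/= (bigD1 i)//= big1 => [|j ji]; last first.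
  by rewrite mnm1E eq_sym (negbTE ji) expr0.
by rewrite mnm1E eqxx expr1 mulr1.
Qed.

Lemma prod_mnm0 (x : 'I_n -> R) : \prod_j x j ^+ @mnm0 n j = 1.
Proof. by rewrite big1// => j _; rewrite mnm0E. Qed.

(** Induction on the list of monomials. Peeling variables off a monomial of degree at most 2 leaves
    [1], one variable or a product of two, and each of these has the required form. *)
Lemma polynomial_fun2_split (q : 'rV[R]_n -> R) : polynomial_fun 2 q ->
  exists c b Q, [/\ xlast b = 0, horizontal_quadratic Q &
    forall x : V, q (xinit x) = c + dotv b x + Q x].
Proof.
move=> [p [sp qp]].
suff : quadratic_split (fun x => q (xinit x)) by [].
under eq_fun do rewrite qp mevalE.
have : forall m, m \in msupp p -> (mdeg m <= 2)%N.
  by move=> m /msize_mdeg_lt /leq_trans /(_ sp).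
elim: (msupp p : seq _) => [|m s IHs] sdeg.
  have [c [b [Q [bl hQ e]]]] := quadratic_splitZ 0 quadratic_split1.
  by exists c, b, Q; split => // x; rewrite -e big_nil mul0r.
under eq_fun do rewrite big_cons.
apply: quadratic_splitD; last first.
  by apply: IHs => m' ms; apply: sdeg; rewrite inE ms orbT.
apply: quadratic_splitZ.
have := sdeg m (mem_head _ _).
have [m0|m0] := posnP (mdeg m).
  move/eqP: m0; rewrite mdeg_eq0 => /eqP -> _.
  under eq_fun do rewrite prod_mnm0.
  exact: quadratic_split1.
have [i [m' ->]] := mnm_split m0.
rewrite mdegD mdeg1.
under eq_fun do rewrite prod_mnmD.
have [m'0|m'0] := posnP (mdeg m').
  move/eqP: m'0; rewrite mdeg_eq0 => /eqP -> _.
  under eq_fun do rewrite prod_mnm0 mulr1.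
  exact: quadratic_splitX.
have [j [m2 ->]] := mnm_split m'0.
rewrite mdegD mdeg1.
under eq_fun do rewrite prod_mnmD.
have [m20 _|m20] := posnP (mdeg m2); last first.
  by rewrite !add1n !ltnS leqNgt m20.
move/eqP: m20; rewrite mdeg_eq0 => /eqP ->.
under eq_fun do rewrite prod_mnm0 mulr1.
exists 0, 0, (fun x => xinit x 0 i * xinit x 0 j); split.
- by rewrite /xlast mxE.
- exact: horizontal_quadraticM.
- by move=> x; rewrite dotvC dotv0 !add0r.
Qed.

End HorizontalQuadratic.

(** * Pointwise expansions with explicit constants and radii *)

Section PointwiseExpansions.
Context {R : realType} {n : nat}.
Local Notation V := 'rV[R]_n.+1.

Lemma bdry_expansion (alpha : R) (Omega : set V) (g : V -> R) :
  bdry_pointwiseC2 alpha Omega g ->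
  exists (c : R) (b : V) (Q : V -> R) (C r : R),
  [/\ xlast b = 0, horizontal_quadratic Q, 0 <= C, 0 < r &
    forall x, bdry Omega x -> enorm x < r ->
      `|g x - (c + dotv b x + Q x)| <= C * hnorm x `^ (2 + alpha)].
Proof.
move=> [q /polynomial_fun2_split[c [b [Q [bh hQ qE]]]]].
move=> /eqO_exP[C C0 /nbhs_ballP[r /= r0 rO]].
exists c, b, Q, C, r; split=> //; first exact: ltW.
move=> x bx xr; have := rO x; rewrite -ball_normE /= sub0r normrN.
move=> /(_ (le_lt_trans (ler_norm_enorm x) xr) bx).
by rewrite qE [X in _ <= _ * X]ger0_norm ?powR_ge0.
Qed.

Lemma enorm_le_norm (x : V) : enorm x <= n.+1%:R * `|x|.
Proof.
rewrite -(@ler_pXn2r _ 2)// ?nnegrE ?enorm_ge0 ?mulr_ge0// sqr_enorm exprMn.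
apply: (@le_trans _ _ (\sum_(i < n.+1) `|x| ^+ 2)).
  apply: ler_sum => i _; rewrite -expr2 -(@real_normK _ (x 0 i)) ?num_real//.
  by rewrite ler_pXn2r ?nnegrE// ler_coord_norm.
rewrite sumr_const card_ord -[leLHS]mulr_natl ler_wpM2r ?sqr_ge0//.
by rewrite expr2 ler_peMl// ler1n.
Qed.

Lemma affine_polynomial_fun (b : V) (c : R) :
  polynomial_fun 1 (fun x : V => dotv b x + c).
Proof.
exists (\sum_i b 0 i *: mpolyX R (mnm1 i) + mpolyC n.+1 c); split.
  apply: (leq_trans (msizeD_le _ _)); rewrite geq_max; apply/andP; split.
    apply: (leq_trans (msize_sum _ _ _)); apply/bigmax_leqP => i _.
    by rewrite (leq_trans (msizeZ_le _ _))// msizeX mdeg1.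
  by rewrite msizeC; case: eqP.
move=> x; rewrite mevalD mevalC raddf_sum /=; congr (_ + _).
by apply: eq_bigr => i _; rewrite mevalZ mevalXU.
Qed.

Lemma pointwiseC1_of_bound (D : set V) (u : V -> R) (b : V) (c delta A r : R) :
  0 < r -> (forall x, D x -> enorm x < r ->
    `|u x - (dotv b x + c)| <= A * enorm x `^ (1 + delta)) ->
  pointwiseC 1 delta D u 0.
Proof.
move=> r0 uA; exists (fun x => dotv b x + c); first exact: affine_polynomial_fun.
(* The constant has to be positive, while [A] is arbitrary. The radius is then divided by [n.+1]
   because neighbourhoods are sup-norm balls. *)
apply/eqO_exP; exists (`|A| + 1); first by rewrite ltr_wpDl.
apply/nbhs_ballP; exists (r / n.+1%:R); first by rewrite /= divr_gt0.
move=> x; rewrite -ball_normE /= sub0r normrN ltr_pdivlMr// mulrC => xr Dx.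
rewrite subr0 (ger0_norm (powR_ge0 _ _)).
apply: le_trans (uA x Dx (le_lt_trans (enorm_le_norm x) xr)) _.
by rewrite ler_wpM2r ?powR_ge0// (le_trans (ler_norm _))// lerDl.
Qed.

End PointwiseExpansions.

(** * Comparison after subtraction of an affine function *)

Section AffineComparison.
Context {R : realType} {n : nat}.
Local Notation V := 'rV[R]_n.+1.

(** The affine function is moved to the barrier, whose Hessian it does not change. The Hessian is
    diagonal, with [2 * A] in the horizontal directions and [2 * B] in the vertical one. *)
Lemma comparison_affine (Omega : set V) (u f : V -> R) (L : R) (b0 : V) (c0 : R) :
  open Omega -> bounded_set Omega -> convex_function (closure Omega) u ->
  {within closure Omega, continuous u} -> alexandrov_solution Omega f u ->
  0 <= L -> (forall x, Omega x -> 0 <= f x <= L) ->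
  forall (D : set V) (A B a : R), open D -> D `<=` Omega ->
  0 < A -> 0 < B -> L < (2 * A) ^+ n * (2 * B) ->
  (forall x, closure D x -> ~ D x ->
    A * hnorm x ^+ 2 + B * xlast x ^+ 2 + a * xlast x <= u x - (dotv b0 x + c0)) ->
  forall x, D x ->
    A * hnorm x ^+ 2 + B * xlast x ^+ 2 + a * xlast x <= u x - (dotv b0 x + c0).
Proof.
move=> oO bO cu ctu MA L0 fL D A B a oD DO A0 B0 LAB vu.
pose d (i : 'I_n.+1) := if i == ord_max then B else A.
have dE (x : V) : \sum_i d i * x 0 i ^+ 2 + dotv (b0 + a *: vertical) x + c0 =
    A * hnorm x ^+ 2 + B * xlast x ^+ 2 + a * xlast x + (dotv b0 x + c0).
  rewrite big_ord_recr/= /d eqxx -/(xlast x) dotvDl dotvZl.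
  rewrite [dotv vertical x]dotv_xinit_xlast xinit_vertical.
  rewrite xlast_vertical (dotvC 0) dotv0.
  rewrite (_ : \sum_(i < n) _ = A * hnorm x ^+ 2); first by ring.
  rewrite sqr_enorm mulr_sumr; apply: eq_bigr => i _.
  by rewrite -val_eqE/= ltn_eqF// !mxE expr2.
move=> x Dx; rewrite lerBrDr -dE.
apply: (comparison_quadratic oO bO oD DO cu ctu MA L0 fL) => //.
- by move=> i; rewrite /d; case: ifP.
- rewrite big_ord_recr/= /d eqxx (eq_bigr (fun=> 2 * A)).
    by rewrite prodr_const card_ord.
  by move=> i _; rewrite -val_eqE/= ltn_eqF.
by move=> y cy nDy; rewrite dE -lerBrDr; exact: vu.
Qed.

End AffineComparison.

(** * Optimal vertical slope at the origin, and bounds on the closure *)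

Section SupportAtOrigin.
Context {R : realType} {n : nat}.
Local Notation V := 'rV[R]_n.+1.
Context (Omega : set V) (oO : open Omega) (bO : bounded_set Omega).
Context (cO : convex_set Omega) (cl0 : closure Omega 0).
Context (OH : Omega `<=` @half_space R n) (n0 : (0 < n)%N).
Context (kappa : R) (k0 : 0 < kappa).
Context (kO : forall x, bdry Omega x -> kappa * enorm x ^+ 2 <= xlast x).
Implicit Types g w : V -> R.

Lemma continuous_closure_bounded g : {within closure Omega, continuous g} ->
  exists2 M, 0 <= M & forall x, closure Omega x -> `|g x| <= M.
Proof.
move=> cg.
have cc : compact (closure Omega).
  by apply: bounded_closed_compact; [exact: bounded_closure|exact: closed_closure].
have [||y _ ymax] := @EVT_max_rV _ _ (fun x => `|g x|) _ _ cc.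
- by exists 0.
- by move=> x; apply: continuous_comp; [exact: cg|exact: norm_continuous].
by exists `|g y| => // x cx; apply: ymax; rewrite inE.
Qed.

(** Near [0], uniform convexity gives [|x'|^2 <= x_n / kappa]. Away from [0], the height is at least
    [kappa r^2] and [g] is bounded by compactness. *)
Lemma boundary_linear_bound g (M1 r : R) : 0 <= M1 -> 0 < r ->
  {within closure Omega, continuous g} ->
  (forall x, bdry Omega x -> enorm x < r -> `|g x| <= M1 * hnorm x ^+ 2) ->
  exists2 C1, 0 <= C1 & forall x, bdry Omega x -> `|g x| <= C1 * xlast x.
Proof.
move=> M10 r0 cg gr; have [M M0 gM] := continuous_closure_bounded cg.
have kr0 : 0 < kappa * r ^+ 2 by rewrite mulr_gt0// exprn_gt0.
exists (M1 / kappa + M / (kappa * r ^+ 2)).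
  by rewrite addr_ge0// divr_ge0// ltW.
move=> x bx; have kx := kO bx.
have x0 : 0 <= xlast x by apply: le_trans kx; rewrite mulr_ge0 ?sqr_ge0// ltW.
have A0 : 0 <= M1 / kappa * xlast x by rewrite mulr_ge0// divr_ge0// ltW.
have B0 : 0 <= M / (kappa * r ^+ 2) * xlast x by rewrite mulr_ge0// divr_ge0// ltW.
rewrite mulrDl; have [xr|rx] := ltP (enorm x) r.
  apply: (le_trans (gr _ bx xr)).
  have : M1 * hnorm x ^+ 2 <= M1 / kappa * xlast x; last by lra.
  rewrite -mulrA; apply: ler_wpM2l => //; rewrite ler_pdivlMl//.
  by apply: le_trans kx; rewrite ler_pM2l// sqr_enorm_split lerDl sqr_ge0.
apply: (le_trans (gM _ (closure_bdry bx))).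
have : M <= M / (kappa * r ^+ 2) * xlast x; last by lra.
rewrite -mulrA ler_peMr// ler_pdivlMl// mulr1; apply: le_trans kx.
by rewrite ler_pM2l// ler_pXn2r ?nnegrE ?enorm_ge0// ltW.
Qed.

(** [a] is the supremum of the slopes that stay below [g]. Comparison with a steep quadratic shows
    that such slopes exist, and one interior point bounds them above. *)
Lemma linear_support g (L C1 : R) : 0 <= L -> 0 <= C1 ->
  (forall (D : set V) (A B a : R), open D -> D `<=` Omega ->
    0 < A -> 0 < B -> L < (2 * A) ^+ n * (2 * B) ->
    (forall x, closure D x -> ~ D x ->
      A * hnorm x ^+ 2 + B * xlast x ^+ 2 + a * xlast x <= g x) ->
    forall x, D x -> A * hnorm x ^+ 2 + B * xlast x ^+ 2 + a * xlast x <= g x) ->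
  (forall x, bdry Omega x -> `|g x| <= C1 * xlast x) ->
  exists a, (forall x, Omega x -> a * xlast x <= g x) /\
    forall e, 0 < e -> exists2 x, Omega x & g x - a * xlast x < e * xlast x.
Proof.
move=> L0 C10 cmp gC.
pose S := [set a : R | forall x, Omega x -> a * xlast x <= g x].
pose A := L + 1.
have A1 : 1 <= A by rewrite lerDr.
have A0 : 0 < A by exact: lt_le_trans ltr01 A1.
have S0 : S !=set0.
  (* On the boundary, [A / kappa] absorbs the quadratic part [A |y|^2] and [C1] absorbs [g]. *)
  exists (- (C1 + A / kappa)) => x Ox.
  have LA : L < (2 * A) ^+ n * (2 * A).
    apply: (@lt_le_trans _ _ (2 * A)).
      rewrite /A; apply: (@lt_le_trans _ _ (1 * A));
        [by rewrite mul1r ltrDl|by rewrite ler_pM2r// ler1n].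
    rewrite ler_peMl ?mulr_ge0// ?(ltW A0)// exprn_ege1//.
    by apply: (le_trans A1); rewrite ler_peMl ?(ltW A0)// ler1n.
  have := cmp Omega A A (- (C1 + A / kappa)) oO (@subset_refl _ _) A0 A0 LA.
  move=> /(_ _ x Ox) h; apply: le_trans (h _).
    by rewrite lerDr addr_ge0// mulr_ge0 ?sqr_ge0// (ltW A0).
  move=> y cy nOy; have by' : bdry Omega y by exact/bdry_notin.
  have := gC _ by'; rewrite ler_norml => /andP[g1 _].
  have : A * enorm y ^+ 2 <= A / kappa * xlast y.
    rewrite -mulrA ler_pM2l// ler_pdivlMl//; exact: kO.
  rewrite sqr_enorm_split; lra.
have [z [Oz _]] : Omega `&` setT !=set0 by apply: cl0; exact: filterT.
have z0 : 0 < xlast z := OH Oz.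
have Sub : ubound S (g z / xlast z).
  by move=> a Sa; rewrite ler_pdivlMr//; exact: Sa.
have supS : has_sup S by split => //; exists (g z / xlast z).
exists (sup S); split.
  move=> x Ox; have x0 : 0 < xlast x := OH Ox.
  rewrite -ler_pdivlMr//; apply: ge_sup => // a Sa.
  by rewrite ler_pdivlMr//; exact: Sa.
move=> e e0; apply: contrapT => ne.
have : S (sup S + e).
  move=> x Ox; rewrite leNgt; apply/negP => gx; apply: ne; exists x => //.
  by lra.
move=> /(ub_le_sup (ex_intro _ _ Sub)); rewrite gerDl leNgt e0//.
Qed.

Lemma convex_ge0_closure w : convex_function (closure Omega) w ->
  (forall x, Omega x -> 0 <= w x) -> forall x, closure Omega x -> 0 <= w x.
Proof.
move=> cw wO x cx; rewrite leNgt; apply/negP => wx.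
have [z [Oz _]] : Omega `&` setT !=set0 by apply: cl0; exact: filterT.
have wz := wO _ Oz.
(* With this weight on [z], the convex combination of the values of [w] is [w x / 2], which is
   negative, although the point is in [Omega]. *)
pose t := - w x / (w z - w x) / 2.
have d0 : 0 < w z - w x by lra.
have t01 : 0 < t <= 1.
  rewrite divr_gt0 ?divr_gt0// ?oppr_gt0//= ler_pdivrMr// ler_pdivrMr//; lra.
have Ot := convex_open_segment oO cO cx Oz t01.
have cz : closure Omega z by exact: subset_closure.
have tt : 0 <= t <= 1 by case/andP: t01 => /ltW -> ->.
have := convex_function_le cw cz cx tt; have := wO _ Ot.
have : t * (w z - w x) = - w x / 2 by rewrite /t; field; rewrite gt_eqF.
lra.
Qed.

(** Convexity on a horizontal chord, where the bound is constant. *)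
Lemma convex_le_closure w (K : R) : convex_function (closure Omega) w ->
  (forall x, bdry Omega x -> w x <= K * xlast x) ->
  forall x, closure Omega x -> w x <= K * xlast x.
Proof.
move=> cw wb x cx; have [Ox|nOx] := pselect (Omega x); last exact/wb/bdry_notin.
have [y [z [t [by' bz yx zx [t01 xE]]]]] := horizontal_chord oO bO n0 Ox.
have := convex_function_le cw (closure_bdry by') (closure_bdry bz) t01.
rewrite -xE; move/le_trans; apply.
have := wb _ by'; have := wb _ bz; rewrite yx zx => h1 h2.
case/andP: t01 => t0 t1; have t1' : 0 <= 1 - t by lra.
have := ler_wpM2l t0 h2; have := ler_wpM2l t1' h1; lra.
Qed.

Lemma convex_function_affine w (b : V) (c : R) : convex_function (closure Omega) w ->
  convex_function (closure Omega) (fun x => w x - (dotv b x + c)).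
Proof.
move=> cw t x y /[!inE] cx cy.
have t01 : 0 <= t%:num <= 1 by rewrite ge0 le1.
have := convex_function_le cw cx cy t01 => h.
rewrite -[leLHS]/(w (t%:num *: x + (1 - t%:num) *: y) -
  (dotv b (t%:num *: x + (1 - t%:num) *: y) + c)).
rewrite -[leRHS]/(t%:num * (w x - (dotv b x + c)) +
  (1 - t%:num) * (w y - (dotv b y + c))).
by rewrite dotvDr !dotvZr; lra.
Qed.

End SupportAtOrigin.

(** * Minimum of a form on the horizontal unit sphere *)

Section SphereMinimum.
Context {R : realType} {n : nat}.
Local Notation V := 'rV[R]_n.+1.

(** A minimum exists by compactness of the sphere, and homogeneity spreads it to all [x]. The sign
    of [P e] later separates the degenerate case from the positive definite one. *)
Lemma horizontal_quadratic_min (P : V -> R) : (0 < n)%N -> horizontal_quadratic P ->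
  exists e : V, [/\ xlast e = 0, hnorm e = 1 &
    forall x, P e * hnorm x ^+ 2 <= P x].
Proof.
move=> n0 [Pv P2 cP _].
pose S := [set e : V | xlast e = 0] `&` [set e : V | dotv e e = 1].
have cS : closed S.
  apply: closedI.
    apply: (@closed_comp _ _ (@xlast R n) [set t | t = 0]); last exact: closed_eq.
    by move=> x _; exact: coord_continuous.
  apply: (@closed_comp _ _ (fun x : V => dotv x x) [set t | t = 1]);
    last exact: closed_eq.
  move=> x _; apply: (@continuous_sum _ _ _ (fun i (x : V) => x 0 i * x 0 i)) => i y.
  by apply: continuousM; exact: coord_continuous.
have bS : bounded_set S.
  exists 1; split=> // r r1 x [_ /= x1]; apply: le_trans (ltW r1).
  by apply: le_trans (ler_norm_enorm x) _; rewrite /enorm x1 sqrtr1.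
have SE (e : V) : xlast e = 0 -> hnorm e = 1 -> S e.
  by move=> eh e1; split=> //=; rewrite -sqr_enorm enorm_horizontal// e1 expr1n.
have [||e /[!inE] -[/= eh e1] emin] :=
    @EVT_min_rV _ _ P _ _ (bounded_closed_compact bS cS).
- by have [e [eh e1]] := @horizontal_unit R n n0; exists e; exact: SE.
- exact: continuous_subspaceT.
exists e; split=> //; first by rewrite -enorm_horizontal// /enorm e1 sqrtr1.
move=> x; have xE : x = (x - xlast x *: vertical) + xlast x *: vertical.
  by rewrite subrK.
have [h0|hn0] := eqVneq (hnorm x) 0.
  have hx : x - xlast x *: vertical = 0.
    by apply: enorm_eq0; rewrite enorm_horizontal ?horizontal_part// hnorm_vertB.
  have P0 : P 0 = 0 by have := P2 0 0; rewrite scale0r expr0n mul0r.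
  by rewrite h0 expr0n mulr0 xE hx Pv P0.
pose d := (hnorm x)^-1 *: (x - xlast x *: vertical).
have Sd : S d.
  apply: SE; first by rewrite xlastZ horizontal_part mulr0.
  by rewrite hnormZ hnorm_vertB ger0_norm ?invr_ge0 ?hnorm_ge0// mulVf.
have := emin d; rewrite inE => /(_ Sd).
have -> : P x = P d * hnorm x ^+ 2.
  rewrite {1}xE Pv /d P2; field => //.
by move=> h; rewrite ler_wpM2r ?sqr_ge0.
Qed.

End SphereMinimum.

(** * Nonnegativity of the boundary form *)

Section NonnegativeForm.
Context {R : realType} {n : nat}.
Local Notation V := 'rV[R]_n.+1.

(** Low slices give boundary points in the direction [e] with [|x'| = s] arbitrarily small, where
    [0 <= w <= s^2 P(e) + O(s^(2 + alpha))]. *)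
Lemma boundary_form_ge0 (Omega : set V) (kappa C t0 : R) (w P : V -> R)
    (alpha C2 r2 : R) (e : V) :
  0 < kappa -> 0 < t0 ->
  (forall t, 0 < t <= t0 ->
    Omega (t *: vertical) /\ forall e : V, xlast e = 0 -> hnorm e = 1 ->
    exists s, [/\ 0 < s, bdry Omega (t *: vertical + s *: e),
      kappa * s ^+ 2 <= t & t <= C * s ^+ 2]) ->
  (forall x, bdry Omega x -> 0 <= w x) ->
  0 < alpha -> 0 <= C2 -> 0 < r2 -> horizontal_quadratic P ->
  (forall x, bdry Omega x -> xlast x < r2 ->
     `|w x - P x| <= C2 * hnorm x `^ (2 + alpha)) ->
  xlast e = 0 -> hnorm e = 1 -> 0 <= P e.
Proof.
move=> k0 t00 slice w_ge0 a0 C20 r20 [Pv P2 _ _] wP eh e1.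
rewrite leNgt; apply/negP => Pe.
have m0 : 0 < - P e / 2 by lra.
have [r r0 rs] := powR_small C20 m0 a0.
pose t := Num.min t0 (Num.min (r2 / 2) (kappa * r ^+ 2)).
have t_gt0 : 0 < t.
  by rewrite !lt_min t00/= divr_gt0//= mulr_gt0// exprn_gt0.
have tt0 : t <= t0 by rewrite ge_min lexx.
have tr2 : t <= r2 / 2 by rewrite !ge_min lexx !orbT.
have tr : t <= kappa * r ^+ 2 by rewrite !ge_min lexx !orbT.
have [_ sl] := slice _ (introT andP (conj t_gt0 tt0)).
have [s [s0 bs ks _]] := sl e eh e1.
have sr : s <= r.
  rewrite -(@ler_pXn2r _ 2)// ?nnegrE ?(ltW s0) ?(ltW r0)//.
  by rewrite -(ler_pM2l k0); exact: le_trans tr.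
have := wP _ bs; rewrite xlastD !xlastZ eh xlast_vertical mulr0 addr0 mulr1.
have tr2' : t < r2 by lra.
move=> /(_ tr2'); have := w_ge0 _ bs.
rewrite (addrC (t *: _)) hnorm_vert Pv P2 hnormZ e1 mulr1 (ger0_norm (ltW s0)).
rewrite powR_2D ?(ltW s0)// ler_norml => ws /andP[_ wl].
have s20 : 0 < s ^+ 2 by rewrite exprn_gt0.
have := rs s; rewrite (ltW s0) sr => /(_ isT) h.
have := ler_wpM2l (ltW s20) h.
have : s ^+ 2 * P e < 0 by rewrite pmulr_rlt0.
lra.
Qed.

End NonnegativeForm.

(** * Normalization of [u] at the origin and conclusion *)

Theorem theorem1p1 (R : realType) (n : nat) (alpha : R) :
  (2 <= n.+1)%N -> 0 < alpha < 1 ->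
  exists delta0 : R, 0 < delta0 <= 1 /\
  forall (lambda Lambda : R) (Omega : set 'rV[R]_n.+1)
         (u f phi : 'rV[R]_n.+1 -> R),
    0 < lambda -> lambda <= Lambda ->
    Omega `<=` @half_space R n ->
    open Omega -> bounded_set Omega -> convex_set Omega ->
    bdry Omega 0 ->
    convex_function (closure Omega) u ->
    {within closure Omega, continuous u} ->
    alexandrov_solution Omega f u ->
    (forall x, bdry Omega x -> u x = phi x) ->
    (forall x, Omega x -> lambda <= f x <= Lambda) ->
    uniformly_convex_at0 Omega ->
    bdry_pointwiseC2 alpha Omega (@xlast R n) ->
    bdry_pointwiseC2 alpha Omega phi ->
    pointwiseC 1 delta0 (closure Omega) u 0.
Proof.
move=> n2 /andP[a0 a1]; have n0 : (0 < n)%N by [].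
pose del : R := n.+3%:R^-1.
have del0 : 0 < del by rewrite invr_gt0.
(* [alpha / 2] is the exponent of the degenerate case and [del] that of the positive definite one.
   As [alpha < 1], the minimum is below [1 / 2], as the passage from the axis to all points
   requires. *)
pose delta := Num.min (alpha / 2) del.
have delta0 : 0 < delta by rewrite lt_min del0 divr_gt0.
have deltaA : delta <= alpha / 2 by rewrite ge_min lexx.
have deltaN : delta <= del by rewrite ge_min lexx orbT.
exists delta; split; first by rewrite delta0/=; lra.
move=> lambda Lambda Omega u f phi l0 lL OH oO bO cO b0 cu ctu MA uphi fL.
move=> [kappa k0 kO] /bdry_expansion[cq [bq [Qq [Cq [rq [bqh hQq Cq0 rq0 qE]]]]]].
move=> /bdry_expansion[c [b [Q [Cp [rp [bh hQ Cp0 rp0 pE]]]]]].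
have cl0 : closure Omega 0 := closure_bdry b0.
have L0 : 0 <= Lambda by lra.
have fL0 (x : 'rV[R]_n.+1) : Omega x -> 0 <= f x <= Lambda.
  by move=> /fL /andP[lf ->]; rewrite andbT (le_trans _ lf)// ltW.
have h00 : hnorm (0 : 'rV[R]_n.+1) = 0 by rewrite -(scale0r 0) hnormZ normr0 mul0r.
have l00 : xlast (0 : 'rV[R]_n.+1) = 0 by rewrite /xlast mxE.
have e00 : enorm (0 : 'rV[R]_n.+1) = 0 by rewrite enorm_horizontal.
have Q00 Q' : horizontal_quadratic Q' -> Q' (0 : 'rV[R]_n.+1) = 0.
  by move=> [_ Q2 _ _]; have := Q2 0 0; rewrite scale0r expr0n mul0r.
(* At [x = 0] the error terms vanish, which determines the constant terms of both expansions. *)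
have cq0 : cq = 0.
  have := qE _ b0; rewrite e00 => /(_ rq0).
  rewrite h00 powR0 ?gt_eqF ?addr_gt0// mulr0 normr_le0 l00 dotv0 (Q00 Qq)//.
  by rewrite !addr0 sub0r oppr_eq0 => /eqP.
have phi0 : u 0 = c.
  have := pE _ b0; rewrite e00 => /(_ rp0).
  rewrite h00 powR0 ?gt_eqF ?addr_gt0// mulr0 normr_le0 dotv0 (Q00 Q)//.
  by rewrite !addr0 subr_eq0 => /eqP <-; exact: uphi.
have hpow (x : 'rV[R]_n.+1) : enorm x < 1 ->
    hnorm x `^ (2 + alpha) <= hnorm x ^+ 2 :> R.
  move=> x1; rewrite -powR_mulrn ?hnorm_ge0//; apply: powR_exp_le => //; last by lra.
  by rewrite hnorm_ge0/= (le_trans (hnorm_le_enorm x))// ltW.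
have [_ _ _ [Kq Kq0 Kqb]] := hQq.
have [_ _ _ [Kp Kp0 Kpb]] := hQ.
pose C := Kq + Cq + 1.
have C0 : 0 < C by rewrite /C; lra.
pose r := Num.min 1 (Num.min rq rp).
have r0 : 0 < r by rewrite !lt_min ltr01 rq0.
have graph (x : 'rV[R]_n.+1) : bdry Omega x -> enorm x < r ->
    `|xlast x - dotv bq x| <= C * hnorm x ^+ 2.
  move=> bx; rewrite !lt_min => /and3P[x1 xq _].
  have := qE _ bx xq; rewrite cq0 add0r => h1.
  have h2 := Kqb x; have h3 := ler_wpM2l Cq0 (hpow x x1).
  have h4 := sqr_ge0 (hnorm x).
  have -> : xlast x - dotv bq x = xlast x - (dotv bq x + Qq x) + Qq x by ring.
  by apply: (le_trans (ler_normD _ _)); rewrite /C !mulrDl mul1r; lra.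
have bq0 := linear_part_eq0 oO bO cO cl0 OH k0 kO bqh C0 r0 graph.
have [t0 t00 slice] := slice_exit oO bO cO cl0 OH k0 kO bqh C0 r0 graph.
have kcl (x : 'rV[R]_n.+1) : closure Omega x -> kappa * enorm x ^+ 2 <= xlast x.
  exact: (closure_kappa oO bO n0 k0 kO).
pose g (x : 'rV[R]_n.+1) := u x - (dotv b x + c).
have cg : {within closure Omega, continuous g}.
  have cb : {within closure Omega, continuous (fun x => dotv b x + c)}.
    apply: continuous_subspaceT => x.
    exact: (continuousD (@dotv_continuous _ _ b x) (@cst_continuous _ _ c x)).
  by move=> x; exact: (continuousB (ctu x) (cb x)).
have gE (x : 'rV[R]_n.+1) : bdry Omega x -> enorm x < rp ->
    `|g x - Q x| <= Cp * hnorm x `^ (2 + alpha).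
  move=> bx xp; have := pE _ bx xp; rewrite -uphi//.
  by rewrite (_ : u x - _ = g x - Q x)// /g; ring.
have [C1 C10 gC1] : exists2 C1, 0 <= C1 &
    forall x, bdry Omega x -> `|g x| <= C1 * xlast x.
  apply: (boundary_linear_bound bO cl0 k0 kO (M1 := Kp + Cp) (r := r)) => //.
    exact: addr_ge0.
  move=> x bx; rewrite !lt_min => /and3P[x1 _ xp].
  have h1 := gE _ bx xp; have h2 := Kpb x; have h3 := ler_wpM2l Cp0 (hpow x x1).
  rewrite -(subrK (Q x) (g x)); apply: (le_trans (ler_normD _ _)).
  by rewrite mulrDl; lra.
have cmpg := comparison_affine (b0 := b) (c0 := c) oO bO cu ctu MA L0 fL0.
have [a [ga ainf]] := linear_support oO cl0 OH k0 kO L0 C10 cmpg gC1.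
pose w (x : 'rV[R]_n.+1) := u x - (dotv (b + a *: vertical) x + c).
have wg (x : 'rV[R]_n.+1) : w x = g x - a * xlast x.
  rewrite /w /g dotvDl dotvZl [dotv vertical x]dotv_xinit_xlast xinit_vertical.
  by rewrite xlast_vertical (dotvC 0) dotv0; ring.
have cw : convex_function (closure Omega) w by exact: convex_function_affine.
have w0 : w 0 = 0 by rewrite /w dotv0 phi0 add0r subrr.
have w_ge0 (x : 'rV[R]_n.+1) : closure Omega x -> 0 <= w x.
  by apply: convex_ge0_closure => // y Oy; rewrite wg subr_ge0; exact: ga.
pose K := C1 + `|a|.
have K0 : 0 <= K by exact: addr_ge0.
have wK (x : 'rV[R]_n.+1) : closure Omega x -> w x <= K * xlast x.
  apply: convex_le_closure => // y by'; rewrite wg mulrDl.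
  have y0 : 0 <= xlast y.
    by apply: le_trans (kO _ by'); rewrite mulr_ge0 ?sqr_ge0// ltW.
  have := gC1 _ by'; have : - a * xlast y <= `|a| * xlast y.
    by apply: ler_wpM2r => //; rewrite -normrN ler_norm.
  by have := ler_norm (g y); lra.
(* On the boundary [x_n] is [Qq] up to the admissible error, so subtracting [a x_n] turns the form
   [Q] into [Q - a Qq]. *)
pose P (x : 'rV[R]_n.+1) := Q x + (- a) * Qq x.
have hP : horizontal_quadratic P.
  by apply: horizontal_quadraticD => //; exact: horizontal_quadraticZ.
pose C2 := Cp + `|a| * Cq.
have C20 : 0 <= C2 by rewrite addr_ge0// mulr_ge0.
pose r2 := kappa * r ^+ 2.
have r20 : 0 < r2 by rewrite mulr_gt0// exprn_gt0.
have small (x : 'rV[R]_n.+1) : bdry Omega x -> xlast x < r2 ->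
    [/\ enorm x < r, enorm x < rq & enorm x < rp].
  move=> bx xr; have xr' := bdry_small k0 kO r0 bx xr.
  by split=> //; move: xr'; rewrite !lt_min => /and3P[].
have wP (x : 'rV[R]_n.+1) : bdry Omega x -> xlast x < r2 ->
    `|w x - P x| <= C2 * hnorm x `^ (2 + alpha).
  move=> bx /(small _ bx)[xr xq xp].
  have h1 := gE _ bx xp; have := qE _ bx xq; rewrite cq0 bq0 dotvC dotv0 !add0r => h2.
  have -> : w x - P x = (g x - Q x) + (- a) * (xlast x - Qq x) by rewrite wg /P; ring.
  apply: (le_trans (ler_normD _ _)); rewrite /C2 mulrDl lerD// normrM normrN -mulrA.
  by rewrite ler_wpM2l.
have [e [eh e1 emin]] := horizontal_quadratic_min n0 hP.
have Pe0 : 0 <= P e.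
  apply: (boundary_form_ge0 k0 t00 slice _ a0 C20 r20 hP wP eh e1) => x bx.
  exact/w_ge0/closure_bdry.
have [A A0 [t1 t10 wv]] : exists2 A, 0 <= A & exists2 t1, 0 < t1 &
    forall t, 0 < t <= t1 -> w (t *: vertical) <= A * t `^ (1 + delta).
  have weaken p : delta <= p -> (exists2 A, 0 <= A & exists2 t1, 0 < t1 &
      forall t, 0 < t <= t1 -> w (t *: vertical) <= A * t `^ (1 + p)) ->
    exists2 A, 0 <= A & exists2 t1, 0 < t1 &
      forall t, 0 < t <= t1 -> w (t *: vertical) <= A * t `^ (1 + delta).
    move=> dp [A A0 [t1 t10 wA]]; exists A => //.
    exists (Num.min 1 t1); first by rewrite lt_min ltr01.
    move=> t; rewrite le_min => /and3P[t_gt0 tl1 tt1].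
    apply: le_trans (wA t _) _; first by rewrite t_gt0.
    apply: ler_wpM2l => //; apply: powR_exp_le; first by rewrite ltW.
      by rewrite addr_gt0.
    by rewrite lerD2l.
  have [Pv P2 _ _] := hP.
  (* If the minimum [P e] is zero, the form degenerates in the direction [e]; otherwise it is
     positive definite with constant [P e]. *)
  move: Pe0; rewrite le_eqVlt => /predU1P[/esym Pe0|Pe_gt0].
    apply: (weaken _ deltaA).
    exact: (vertical_growth_degenerate k0 t00 slice cw a0 C20 r20 Pv P2 wP eh e1 Pe0).
  apply: (weaken _ deltaN).
  have xC (x : 'rV[R]_n.+1) : bdry Omega x -> xlast x < r2 ->
      xlast x <= C * hnorm x ^+ 2.
    move=> bx /(small _ bx)[xr _ _]; have := graph _ bx xr.
    by rewrite bq0 dotvC dotv0 subr0; apply: le_trans; exact: ler_norm.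
  have [c1 c10 [r3 r30 wlow]] :=
    boundary_lower_bound k0 C0 kcl a0 C20 r20 Pe_gt0 xC emin wP.
  have cmpw (D : set 'rV[R]_n.+1) (A B a' : R) : open D -> D `<=` Omega ->
      0 < A -> 0 < B -> Lambda < (2 * A) ^+ n * (2 * B) ->
      (forall x, closure D x -> ~ D x ->
        A * hnorm x ^+ 2 + B * xlast x ^+ 2 + a' * xlast x <= w x) ->
      forall x, D x -> A * hnorm x ^+ 2 + B * xlast x ^+ 2 + a' * xlast x <= w x.
    exact: (comparison_affine (b0 := b + a *: vertical) (c0 := c) oO bO cu ctu MA L0 fL0).
  have w_inf e' : 0 < e' -> exists2 x, Omega x & w x < e' * xlast x.
    by move=> /ainf[x Ox gx]; exists x => //; rewrite wg.
  exact: (vertical_growth_nondegenerate k0 C0 t00 kcl slice K0 cw w0 w_ge0 wK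
    L0 cmpw w_inf oO cO cl0 OH c10 r30 wlow).
have d12 : 0 < delta <= 1 / 2 by rewrite delta0/=; lra.
have [A' A'0 [r' r'0 wA]] :=
  growth_from_vertical k0 C0 t00 kcl slice K0 cw w0 w_ge0 wK d12 t10 A0 wv.
apply: (@pointwiseC1_of_bound _ _ _ u (b + a *: vertical) c delta A' r' r'0) => x cx xr.
by rewrite -/(w x) ger0_norm ?w_ge0// wA.
Qed.
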